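(* Let $m,j\in\mathbb{N}$, and let $f\in\Phi_m$ be non-constant with Schoenberg measure $\nu_m$. Assume that $f\in\Phi_{m+2j}$, with Schoenberg measure $\nu=\nu_{m+2j}$. Let $$p_m(x)=\frac{2x^{m-1}}{B\left(\frac m2,j\right)}\int_x^\infty\Big(1-\frac{x^2}{u^2}\Big)^{j-1}\frac{\nu(du)}{u^m}$$ be the density of $\nu_m$, $\nu_m(dx)=p_m(x)\,dx$. Then the following hold. (i) $\nu_m\in AC^{j}_{\mathrm{loc}}(\mathbb{R}_+)$, where $\nu_m$ is identified with its distribution function. (ii) If $\nu$ is absolutely continuous, $\nu=p_{m+2j}\,dx$, and $p_{m+2j}\in L^p(\mathbb{R}_+)$ for some $1\le p<\infty$, then $$x^kp_m^{(k)}(x)\in L^p(\mathbb{R}_+),\qquad k=0,1,\dots,j-1.$$ Moreover, $$p_m^{(k)}(x)=o\Big(\frac1{x^{k+1}}\Big),\quad x\to\infty,\qquad k=0,1,\dots,j-1.$$ (iii) Let $\nu$ satisfy $I:=\int_0^\infty\frac{\nu(du)}{u}<\infty$. Then $$p_m(0)=\lim_{x\to0+}p_m(x)=0\ \text{ for } m\ge2,\qquad p_1(0)=I.$$ Furthermore, $$x^kp_m^{(k)}(x)\in L^\infty(\mathbb{R}_+),\qquad k=0,1,\dots,j-1.$$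
   Context: For $n\in\mathbb{N}$, $|\cdot|_n$ is the Euclidean norm on $\mathbb{R}^n$. $\Phi_n$ is the class of radial positive definite functions on $\mathbb{R}^n$: real-valued continuous functions $f$ on $[0,\infty)$ such that for every finite set $\{x_1,\dots,x_N\}\subset\mathbb{R}^n$ and all $\xi_1,\dots,\xi_N\in\mathbb{C}$ one has $\sum_{i,l=1}^N f(|x_i-x_l|_n)\,\xi_l\overline{\xi_i}\ge 0$. The Schoenberg kernel is, with $q=\frac n2-1$, $$\Omega_n(s)=\Gamma(q+1)\Big(\frac2s\Big)^qJ_q(s)=\sum_{i=0}^\infty\frac{\Gamma(q+1)}{i!\,\Gamma(i+q+1)}\Big(-\frac{s^2}{4}\Big)^i,$$ where $J_q$ is the Bessel function of the first kind. By Schoenberg's theorem, every $f\in\Phi_n$, normalized by $f(0)=1$, has the form $f(r)=\int_0^\infty\Omega_n(rt)\,\nu_n(dt)$, $r\ge0$, for a unique probability measure $\nu_n$ on $[0,\infty)$, called the Schoenberg measure of $f\in\Phi_n$. $B(a,b)=\Gamma(a)\Gamma(b)/\Gamma(a+b)$ is the Euler beta function. $C^k(\mathbb{R}_+)$ is the space of $k$ times continuously differentiable functions on the open half-line $(0,\infty)$; $AC[0,a]$ is the space of absolutely continuous functions on $[0,a]$; $AC_{\mathrm{loc}}(\mathbb{R}_+)=\{h: h\in AC[0,a]\ \text{for all } a>0\}$; and $AC^k_{\mathrm{loc}}(\mathbb{R}_+)=\{h\in C^{k-1}(\mathbb{R}_+): h^{(k-1)}\in AC_{\mathrm{loc}}(\mathbb{R}_+)\}$.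 $L^p(\mathbb{R}_+)$ is taken with respect to Lebesgue measure, and $p_m^{(k)}$ is the $k$-th derivative of $p_m$.
   Formalization: In (i), for j≥2 the (j−1)-th derivative of the distribution function is AC on compact subintervals of (0,∞) rather than on [0,a] (it can blow up at 0); in (iii), p_1(0)=I is corrected to p_1(0)=2I/B(1/2,j), which equals I only for j=1. *)

(* Defs.v *)
From HB Require Import structures.
From mathcomp Require Import all_boot all_order all_algebra.
From mathcomp Require Import all_classical all_reals all_analysis.
From mathcomp Require Import complex.

Set Implicit Arguments.
Unset Strict Implicit.
Unset Printing Implicit Defensive.

Import Order.TTheory GRing.Theory Num.Theory.
Import numFieldNormedType.Exports.

Local Open Scope classical_set_scope.
Local Open Scope ring_scope.

(* 'rV[R]_n carries the sup norm in MathComp-Analysis. *)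
Definition euclidean_norm (R : realType) (n : nat) (x : 'rV[R]_n) : R :=
  Num.sqrt (\sum_(i < n) x 0 i ^+ 2).

(* A function on the closed half-line is a total function of which only the
   restriction to [0, +oo[ matters.  The order of R[i] makes [0 <= z] mean that
   z is real and nonnegative. *)
Definition radial_positive_definite (R : realType) (n : nat) (f : R -> R) :=
  {within `[0, +oo[, continuous f} /\
  forall (N : nat) (x : 'I_N -> 'rV[R]_n) (xi : 'I_N -> R[i]),
    0 <= \sum_(i < N) \sum_(l < N)
           real_complex R (f (euclidean_norm (x i - x l))) * xi l * (xi i)^*%R.

Definition Gamma (R : realType) (a : R) : R :=
  \int[lebesgue_measure]_(t in `]0%R, +oo[) (t `^ (a - 1) * expR (- t)).

Definition Beta (R : realType) (a b : R) : R :=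
  Gamma a * Gamma b / Gamma (a + b).

Definition schoenberg_kernel (R : realType) (n : nat) (s : R) : R :=
  let q : R := n%:R / 2 - 1 in
  limn (series (fun i : nat =>
    Gamma (q + 1) / (i`!%:R * Gamma (i%:R + q + 1)) * (- (s ^+ 2 / 4)) ^+ i)).

(* Measures on the closed half-line are measures on the line that do not charge
   the negative numbers. *)
Definition schoenberg_measure (R : realType) (n : nat) (f : R -> R)
    (nu : probability (measurableTypeR R) R) :=
  nu `]-oo, 0[%classic = 0%E /\
  forall r : R, 0 <= r ->
    (f r)%:E = (\int[nu]_(t in `[0%R, +oo[) (schoenberg_kernel n (r * t))%:E)%E.

(* An atom of nu at x contributes nothing when j > 1, since the integrand
   vanishes at u = x; when j = 1 the open lower bound fixes the right-continuous
   version.  At x = 0 the value is 0 if m > 1 and, if m = 1, it is 2 / B(1/2, j)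
   times the integral of nu(du) / u over the open half-line; this factor is 1 for
   j = 1 but, for instance, 3 / 2 for j = 2. *)
Definition schoenberg_density (R : realType) (m j : nat)
    (nu : probability (measurableTypeR R) R) (x : R) : R :=
  2 * x ^+ m.-1 / Beta (m%:R / 2) j%:R *
  \int[nu]_(u in `]x, +oo[) ((1 - x ^+ 2 / u ^+ 2) ^+ j.-1 / u ^+ m).

Definition density_on (R : realType) (D : set R)
    (nu : probability (measurableTypeR R) R) (p : R -> R) :=
  measurable_fun D p /\
  forall A : set R, measurable A -> A `<=` D ->
    nu A = (\int[lebesgue_measure]_(x in A) (p x)%:E)%E.

Definition distribution_function (R : realType)
    (nu : probability (measurableTypeR R) R) (x : R) : R :=
  fine (nu `[0, x]%classic).

Definition diff_on_pos (R : realType) (k : nat) (h : R -> R) :=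
  forall (i : nat) (x : R), (i < k)%N -> 0 < x -> derivable (derive1n i h) x 1.

Definition Ck_pos (R : realType) (k : nat) (h : R -> R) :=
  diff_on_pos k h /\ forall x : R, 0 < x -> {for x, continuous (derive1n k h)}.

Definition absolutely_continuous (R : realType) (a b : R) (h : R -> R) :=
  forall e : R, 0 < e -> exists2 d : R, 0 < d &
    forall (n : nat) (s t : 'I_n -> R),
      (forall i, [/\ a <= s i, s i <= t i & t i <= b]) ->
      trivIset setT (fun i => `]s i, t i[%classic) ->
      \sum_(i < n) (t i - s i) < d ->
      \sum_(i < n) `|h (t i) - h (s i)| < e.

(* The function itself is absolutely continuous up to the endpoint 0.  For
   k > 1 the derivative of order k - 1 is a function on the open half-line which
   may be unbounded near 0, and its absolute continuity is meant on the compact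
   subintervals of the open half-line.  For k = 1 the last condition follows
   from the first one. *)
Definition ACk_loc (R : realType) (k : nat) (h : R -> R) :=
  [/\ forall a : R, 0 < a -> absolutely_continuous 0 a h,
      Ck_pos k.-1 h
    & forall a b : R, 0 < a -> a < b ->
        absolutely_continuous a b (derive1n k.-1 h)].

Definition Lp_pos (R : realType) (p : \bar R) (h : R -> R) :=
  ((h \_ `]0%R, +oo[) : measurableTypeR R -> R) \in Lfun lebesgue_measure p.

Canonical pinfty_filter_on (R : realType) :=
  FilterType (pinfty_nbhs R) filter_filter.

(* Main.v *)
Require Import Defs.
From mathcomp Require Import all_boot all_order all_algebra.
From mathcomp Require Import all_classical all_reals all_analysis.
From mathcomp Require Import measurable_realfun ess_sup_inf ring lra.

Import Order.TTheory GRing.Theory Num.Theory.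
Import numFieldNormedType.Exports.

Local Open Scope classical_set_scope.
Local Open Scope ring_scope.

Set Implicit Arguments.
Unset Strict Implicit.
Unset Printing Implicit Defensive.

(** Write J = j - 1, b = m + 2 J and, for x > 0,
      K_i(x) = the integral over u > x of (u^2 - x^2)^i / u^b against nu.
    Since 1 - x^2 / u^2 = (u^2 - x^2) / u^2, the density is
    p_m(x) = c x^(m-1) K_J(x), and the theorem is about the tail moments K_i.

    Monotonicity of the integrand alone gives, for 0 < x <= y, the sandwich
      (i+1) (y^2 - x^2) K_i(y) <= K_(i+1)(x) - K_(i+1)(y)
                               <= (i+1) (y^2 - x^2) K_i(x)
    ([tail_moment_increment]).  Hence K_(i+1) is Lipschitz on compact
    subintervals of the open half-line, and its derivative is -2 (i+1) x K_i(x)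
    at each x where K_i is continuous: everywhere if i > 0, and off the atoms of
    nu if i = 0.  With T_r(x) = x^(m-1+2r) K_(J-r)(x), the Euler operator x d/dx
    therefore maps T_r to (m-1+2r) T_r - 2 (J-r) T_(r+1), so that x^k p_m^(k)(x)
    is a combination with constant coefficients of T_0, ..., T_k
    ([derive1n_euler_sum]); only the last order k = J has to avoid the atoms.

    (i) The distribution function of nu_m is absolutely continuous on [0, a]
    because its density is integrable.  For j > 1 its derivative is p_m, and the
    derivative of order j - 2 of p_m is a combination of products of powers of x
    with tail moments K_i, i > 0, hence locally Lipschitz.

    (ii) and (iii) On the range of integration x < u, so
    0 <= T_r(x) <= H(x) = the integral over u > x of 1/u against nu
    ([scaled_moment_bounds]), and each claim on x^k p_m^(k)(x) follows from one
    on H.  The decay at infinity is x H(x) <= nu(]x, +oo[) -> 0.  If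
    nu(du) = g(u) du, then H(x) is the integral over u > x of g(u) / u and the
    dual Hardy inequality bounds its L^p norm by that of g.  If I is finite, then
    H <= I, the atoms form a countable set, and the limit at 0 follows from
    dominated convergence.  The value p_1(0) = I for j = 1 amounts to
    B(1/2, 1) = 2. *)

(** * Lipschitz and absolutely continuous functions on an interval *)

Section lipschitz.
Context {R : realType}.
Implicit Types (a b x y : R) (f g h : R -> R).

Definition lipschitz_on a b h := exists L : R,
  forall x y, a <= x -> x <= y -> y <= b -> `|h y - h x| <= L * (y - x).

Lemma lipschitz_on_const a b (c : R) : lipschitz_on a b (fun=> c).
Proof. by exists 0 => x y _ _ _; rewrite subrr normr0 mul0r. Qed.

Lemma lipschitz_on_id a b : lipschitz_on a b (fun x => x).
Proof. by exists 1 => x y _ xy _; rewrite mul1r ger0_norm// subr_ge0. Qed.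

Lemma lipschitz_onD a b f g :
  lipschitz_on a b f -> lipschitz_on a b g -> lipschitz_on a b (fun x => f x + g x).
Proof.
move=> [L fL] [M gM]; exists (L + M) => x y ax xy yb.
rewrite opprD addrACA mulrDl; apply: (le_trans (ler_normD _ _)).
by apply: lerD; [exact: fL|exact: gM].
Qed.

Lemma lipschitz_on_sum a b n (F : 'I_n -> R -> R) :
  (forall i, lipschitz_on a b (F i)) -> lipschitz_on a b (fun x => \sum_(i < n) F i x).
Proof.
elim: n F => [|n ih] F lF.
  by under eq_fun do rewrite big_ord0; exact: lipschitz_on_const.
under eq_fun do rewrite big_ord_recl; apply: lipschitz_onD => //.
exact: ih.
Qed.

Lemma lipschitz_on_bounded a b f : lipschitz_on a b f ->
  exists2 M : R, 0 <= M & forall x, a <= x -> x <= b -> `|f x| <= M.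
Proof.
move=> [L fL]; exists (`|f a| + `|L| * `|b - a|) => [|x ax xb].
  by rewrite addr_ge0// mulr_ge0.
rewrite -(subrK (f a) (f x)) addrC; apply: (le_trans (ler_normD _ _)).
rewrite lerD2l; apply: (le_trans (fL _ _ (lexx a) ax xb)).
have xa : 0 <= x - a by rewrite subr_ge0.
rewrite (le_trans (ler_norm _))// normrM ler_wpM2l//.
by rewrite !ger0_norm ?lerB// subr_ge0 (le_trans ax).
Qed.

Lemma lipschitz_onM a b f g :
  lipschitz_on a b f -> lipschitz_on a b g -> lipschitz_on a b (fun x => f x * g x).
Proof.
move=> lf lg; have [A A0 fA] := lipschitz_on_bounded lf.
have [B B0 gB] := lipschitz_on_bounded lg.
case: lf lg => [L fL] [M gM]; exists (A * M + B * L) => x y ax xy yb.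
have -> : f y * g y - f x * g x = f y * (g y - g x) + g x * (f y - f x) by ring.
rewrite mulrDl -!mulrA; apply: (le_trans (ler_normD _ _)); rewrite !normrM.
apply: lerD; apply: ler_pM => //.
- by apply: fA => //; exact: le_trans xy.
- exact: gM.
- by apply: gB => //; exact: le_trans xy yb.
- exact: fL.
Qed.

Lemma lipschitz_on_expr a b n : lipschitz_on a b (fun x => x ^+ n).
Proof.
elim: n => [|n ih]; first by under eq_fun do rewrite expr0; exact: lipschitz_on_const.
under eq_fun do rewrite exprS; apply: lipschitz_onM => //; exact: lipschitz_on_id.
Qed.

Lemma lipschitz_on_exprV a b n : 0 < a -> lipschitz_on a b (fun x => x ^- n).
Proof.
move=> a0; have lV : lipschitz_on a b (fun x => x^-1).
  exists (a ^- 2) => x y ax xy yb.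
  have x0 := lt_le_trans a0 ax; have y0 := lt_le_trans x0 xy.
  have -> : y^-1 - x^-1 = - ((x * y)^-1 * (y - x)).
    by field; rewrite !gt_eqF.
  have yx : 0 <= y - x by rewrite subr_ge0.
  rewrite normrN normrM (ger0_norm yx) ler_wpM2r//.
  have xy0 : 0 < x * y by rewrite mulr_gt0.
  rewrite gtr0_norm ?invr_gt0// lef_pV2 ?posrE ?exprn_gt0//.
  by rewrite expr2 ler_pM ?(ltW a0)// (le_trans ax).
elim: n => [|n ih].
  by under eq_fun do rewrite expr0 invr1; exact: lipschitz_on_const.
under eq_fun do rewrite exprS invfM.
exact: lipschitz_onM.
Qed.

Lemma eq_lipschitz_on a b f g : (forall x, a <= x -> x <= b -> f x = g x) ->
  lipschitz_on a b f -> lipschitz_on a b g.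
Proof.
move=> fg [L fL]; exists L => x y ax xy yb.
by rewrite -!fg//; [exact: fL|exact: le_trans yb|exact: le_trans xy].
Qed.

Lemma lipschitz_on_continuous a b x h : lipschitz_on a b h -> a < x -> x < b ->
  {for x, continuous h}.
Proof.
move=> [L hL] ax xb; have M0 : 0 < `|L| + 1 by rewrite ltr_wpDl.
apply/cvgrPdist_le => e e0; near=> y.
have ay : a < y by near: y; exact: lt_nbhsr.
have yb : y < b by near: y; exact: lt_nbhsl.
apply: (@le_trans _ _ ((`|L| + 1) * `|x - y|)); last first.
  rewrite mulrC -ler_pdivlMr//; near: y; apply: cvgr_dist_le; first exact: cvg_id.
  by rewrite divr_gt0.
have LM : L <= `|L| + 1 by rewrite (le_trans (ler_norm _))// lerDl.
have [yx|xy] := leP y x.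
  have yx0 : 0 <= x - y by rewrite subr_ge0.
  rewrite (ger0_norm yx0) (le_trans (hL y x (ltW ay) yx (ltW xb)))//.
  by rewrite ler_wpM2r.
have yx0 : 0 <= y - x by rewrite subr_ge0 ltW.
rewrite distrC (distrC x) (ger0_norm yx0).
rewrite (le_trans (hL x y (ltW ax) (ltW xy) (ltW yb)))//.
by rewrite ler_wpM2r.
Unshelve. all: by end_near. Qed.

Lemma lipschitz_on_absolutely_continuous a b h : lipschitz_on a b h ->
  absolutely_continuous a b h.
Proof.
move=> [L hL] e e0; have M0 : 0 < `|L| + 1 by rewrite ltr_wpDl.
exists (e / (`|L| + 1)); first by rewrite divr_gt0.
move=> n s t st _; rewrite ltr_pdivlMr// mulrC; apply: le_lt_trans.
rewrite mulr_sumr; apply: ler_sum => i _; have [ai ti bi] := st i.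
rewrite (le_trans (hL _ _ ai ti bi))// ler_wpM2r ?subr_ge0//.
by rewrite (le_trans (ler_norm _))// lerDl.
Qed.

End lipschitz.

Lemma absolutely_continuous_continuous (R : realType) (a b x : R) (h : R -> R) :
  absolutely_continuous a b h -> a < x -> x < b -> {for x, continuous h}.
Proof.
move=> ach ax xb; apply/cvgrPdist_le => e e0; have [d d0 hd] := ach e e0.
have tI1 (s t : 'I_1 -> R) : trivIset setT (fun i => `]s i, t i[%classic).
  by apply/trivIsetP => i i' _ _; rewrite (ord1 i) (ord1 i') eqxx.
near=> y.
have ay : a < y by near: y; exact: lt_nbhsr.
have yb : y < b by near: y; exact: lt_nbhsl.
have xyd : `|x - y| < d by near: y; apply: cvgr_dist_lt => //; exact: cvg_id.
apply: ltW; have [yx|xy] := leP y x.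
  have := hd 1 (fun=> y) (fun=> x); rewrite !big_ord1; apply => //.
  - by move=> _; rewrite (ltW ay) yx (ltW xb).
  - by rewrite -(ger0_norm (_ : 0 <= x - y)) ?subr_ge0.
rewrite distrC; have := hd 1 (fun=> x) (fun=> y); rewrite !big_ord1; apply => //.
- by move=> _; rewrite (ltW ax) (ltW xy) (ltW yb).
- by rewrite -(ger0_norm (_ : 0 <= y - x)) ?subr_ge0 1?distrC// ltW.
Unshelve. all: by end_near. Qed.

(** * Moments of a measure truncated from below *)

Section tail_kernel.
Context {R : realType}.
Implicit Types (b i : nat) (x y u : R).

Definition tail_kernel b i x u : R :=
  if x < u then (u ^+ 2 - x ^+ 2) ^+ i / u ^+ b else 0.

Lemma subr_sqr_ge0 x u : 0 <= x -> x < u -> 0 <= u ^+ 2 - x ^+ 2.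
Proof. by move=> x0 xu; rewrite subr_ge0 lerXn2r// ?nnegrE ?ltW// (le_lt_trans x0). Qed.

Lemma tail_kernel_ge0 b i x u : 0 <= x -> 0 <= tail_kernel b i x u.
Proof.
move=> x0; rewrite /tail_kernel; case: ltP => // xu.
rewrite divr_ge0 ?exprn_ge0 ?subr_sqr_ge0//.
exact: (le_trans x0 (ltW xu)).
Qed.

Lemma tail_kernel_le b i x u : (i.*2 <= b)%N -> 0 < x ->
  tail_kernel b i x u <= x ^- (b - i.*2).
Proof.
move=> ib x0; rewrite /tail_kernel; case: ltP => xu; last first.
  by rewrite invr_ge0 exprn_ge0// ltW.
have u0 : 0 < u := lt_trans x0 xu.
have -> : u ^+ b = u ^+ (b - i.*2) * u ^+ i.*2 by rewrite -exprD subnK.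
rewrite invfM mulrCA -[leRHS]mulr1 ler_pM//.
- by rewrite invr_ge0 exprn_ge0// ltW.
- by rewrite divr_ge0 ?exprn_ge0 ?subr_sqr_ge0// ltW.
- by rewrite lef_pV2 ?posrE ?exprn_gt0// lerXn2r ?nnegrE ?ltW.
rewrite ler_pdivrMr ?exprn_gt0// mul1r -mul2n exprM lerXn2r//.
- by rewrite nnegrE subr_sqr_ge0// ltW.
- by rewrite nnegrE exprn_ge0// ltW.
- by rewrite gerBl sqr_ge0.
Qed.

Lemma tail_kernel_nonincreasing b i x y u : 0 <= x -> x <= y ->
  tail_kernel b i y u <= tail_kernel b i x u.
Proof.
move=> x0 xy; have y0 := le_trans x0 xy.
rewrite {1}/tail_kernel; case: ltP => yu; last exact: tail_kernel_ge0.
have xu := le_lt_trans xy yu.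
rewrite /tail_kernel xu ler_wpM2r//.
  by rewrite invr_ge0 exprn_ge0// (le_trans x0 (ltW xu)).
by rewrite lerXn2r ?nnegrE ?subr_sqr_ge0// lerB// lerXn2r.
Qed.

Lemma subrX_bounds (a c : R) i : 0 <= c -> c <= a ->
  i.+1%:R * (a - c) * c ^+ i <= a ^+ i.+1 - c ^+ i.+1
    <= i.+1%:R * (a - c) * a ^+ i.
Proof.
move=> c0 ca; have a0 := le_trans c0 ca.
rewrite subrXX.
have E : forall z : R, i.+1%:R * (a - c) * z = (a - c) * \sum_(k < i.+1) z.
  by move=> z; rewrite sumr_const card_ord -mulr_natl; ring.
rewrite !E; apply/andP; split; apply: ler_wpM2l; rewrite ?subr_ge0//;
  apply: ler_sum => k _.
  have -> : c ^+ i = c ^+ (i - k) * c ^+ k by rewrite -exprD subnK// -ltnS.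
  by rewrite /= ler_wpM2r ?exprn_ge0// lerXn2r.
have -> : a ^+ i = a ^+ (i - k) * a ^+ k by rewrite -exprD subnK// -ltnS.
by rewrite /= ler_wpM2l ?exprn_ge0// lerXn2r.
Qed.

(** With A = u^2 - x^2 and B = u^2 - y^2, the difference A^(i+1) - B^(i+1) is
    compared with (i+1) (A - B) B^i and (i+1) (A - B) A^i, and A - B = y^2 - x^2
    does not depend on u.  For x < u <= y the kernel at y vanishes, while
    A <= y^2 - x^2.  The indicators make the case i = 0 fit the same pattern. *)
Lemma tail_kernel_increment b i x y u : 0 <= x -> x <= y ->
  i.+1%:R * (y ^+ 2 - x ^+ 2) * tail_kernel b i y u
    <= tail_kernel b i.+1 x u - tail_kernel b i.+1 y u
    <= i.+1%:R * (y ^+ 2 - x ^+ 2) * tail_kernel b i x u.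
Proof.
move=> x0 xy; have y0 := le_trans x0 xy; rewrite /tail_kernel.
have [xu|ux] := ltP x u; last first.
  by rewrite ltNge (le_trans ux xy)/= subrr !mulr0 lexx.
have ub : 0 <= (u ^+ b)^-1 by rewrite invr_ge0 exprn_ge0// (le_trans x0 (ltW xu)).
have [yu|uy] := ltP y u; last first.
  rewrite mulr0 subr0 divr_ge0 ?exprn_ge0 ?subr_sqr_ge0//=; last first.
    exact: le_trans x0 (ltW xu).
  rewrite mulrA ler_wpM2r// exprS ler_wpM2r ?exprn_ge0 ?subr_sqr_ge0//.
  have yx : u ^+ 2 - x ^+ 2 <= y ^+ 2 - x ^+ 2.
    by rewrite lerB// lerXn2r ?nnegrE// (le_trans x0 (ltW xu)).
  apply: (le_trans yx); rewrite ler_peMl ?ler1n//.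
  exact: le_trans (subr_sqr_ge0 _ _) yx.
rewrite -mulrBl !mulrA !ler_wpM2r//.
  have := @subrX_bounds (u ^+ 2 - x ^+ 2) (u ^+ 2 - y ^+ 2) i.
  have -> : u ^+ 2 - x ^+ 2 - (u ^+ 2 - y ^+ 2) = y ^+ 2 - x ^+ 2 by ring.
  by move=> /(_ _ _)/andP[]//; rewrite ?subr_sqr_ge0// lerB// lerXn2r.
have := @subrX_bounds (u ^+ 2 - x ^+ 2) (u ^+ 2 - y ^+ 2) i.
have -> : u ^+ 2 - x ^+ 2 - (u ^+ 2 - y ^+ 2) = y ^+ 2 - x ^+ 2 by ring.
by move=> /(_ _ _)/andP[]//; rewrite ?subr_sqr_ge0// lerB// lerXn2r.
Qed.

Lemma measurable_tail_kernel b i x : 0 <= x ->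
  measurable_fun [set: measurableTypeR R] (tail_kernel b i x).
Proof.
move=> x0; rewrite (_ : tail_kernel b i x =
    fun u => if x < u then (u ^+ 2 - x ^+ 2) ^+ i * u `^ (- b%:R) else 0).
  apply: measurable_fun_ifT => //=; first exact: measurable_fun_ltr.
  apply: measurable_funM => /=; last exact: measurable_powR.
  by apply: measurable_funX; apply: measurable_funB => //; apply: measurable_funX.
apply/funext => u; rewrite /tail_kernel; case: ltP => // xu.
by rewrite powR_invn// (le_trans x0 (ltW xu)).
Qed.

End tail_kernel.

Section tail_moment.
Context {R : realType} (nu : probability (measurableTypeR R) R).
Implicit Types (b i : nat) (x y u : R).

Definition tail_moment b i x : R := \int[nu]_u tail_kernel b i x u.

Lemma integrable_tail_kernel b i x : (i.*2 <= b)%N -> 0 < x ->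
  nu.-integrable setT (EFin \o tail_kernel b i x).
Proof.
move=> ib x0; apply: (@le_integrable _ _ _ nu _ measurableT _
  (EFin \o cst (x ^- (b - i.*2)))).
- by apply/measurable_EFinP; apply: measurable_tail_kernel; exact: ltW.
- move=> u _ /=; have x0' := ltW x0.
  by rewrite lee_fin !ger0_norm ?invr_ge0 ?exprn_ge0 ?tail_kernel_ge0// tail_kernel_le.
- exact: finite_measure_integrable_cst.
Qed.

Lemma tail_moment_ge0 b i x : 0 <= x -> 0 <= tail_moment b i x.
Proof. by move=> x0; apply: Rintegral_ge0 => u _; exact: tail_kernel_ge0. Qed.

Lemma tail_moment_nonincreasing b i x y : (i.*2 <= b)%N -> 0 < x -> x <= y ->
  tail_moment b i y <= tail_moment b i x.
Proof.
move=> ib x0 xy; apply: le_Rintegral => //.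
- by apply: integrable_tail_kernel => //; exact: lt_le_trans xy.
- exact: integrable_tail_kernel.
- by move=> u _; apply: tail_kernel_nonincreasing => //; exact: ltW.
Qed.

(** This replaces differentiation under the integral sign: it yields both the
    Lipschitz bound and the derivative, and it stays meaningful when nu has atoms. *)
Lemma tail_moment_increment b i x y : (i.+1.*2 <= b)%N -> 0 < x -> x <= y ->
  i.+1%:R * (y ^+ 2 - x ^+ 2) * tail_moment b i y
    <= tail_moment b i.+1 x - tail_moment b i.+1 y
    <= i.+1%:R * (y ^+ 2 - x ^+ 2) * tail_moment b i x.
Proof.
move=> ib x0 xy; have y0 := lt_le_trans x0 xy.
have ib' : (i.*2 <= b)%N by apply: leq_trans ib; rewrite leq_double.
rewrite /tail_moment -RintegralB//; [|exact: integrable_tail_kernel..].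
have intZ z c : 0 < z ->
    nu.-integrable setT (EFin \o (fun u => c * tail_kernel b i z u)).
  move=> z0; under [X in integrable _ _ X]eq_fun do rewrite /= EFinM.
  by apply: integrableZl => //; exact: integrable_tail_kernel.
have intB : nu.-integrable setT
    (EFin \o (fun u => tail_kernel b i.+1 x u - tail_kernel b i.+1 y u)).
  under [X in integrable _ _ X]eq_fun do rewrite /= EFinB.
  by apply: integrableB => //; exact: integrable_tail_kernel.
rewrite -!RintegralZl//; [|exact: integrable_tail_kernel..].
apply/andP; split; apply: le_Rintegral; rewrite //; try exact: intZ;
  by move=> u _; have /andP[] := @tail_kernel_increment _ b i x y u (ltW x0) xy.
Qed.

Lemma lipschitz_on_tail_moment b i a c : (i.+1.*2 <= b)%N -> 0 < a ->
  lipschitz_on a c (tail_moment b i.+1).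
Proof.
move=> ib a0; exists (i.+1%:R * (c + c) * tail_moment b i a) => x y ax xy yc.
have ib' : (i.*2 <= b)%N by apply: leq_trans ib; rewrite leq_double.
have x0 := lt_le_trans a0 ax; have y0 := lt_le_trans x0 xy.
have c0 := lt_le_trans y0 yc.
rewrite distrC ger0_norm; last first.
  by rewrite subr_ge0 tail_moment_nonincreasing.
have /andP[_ /le_trans] := @tail_moment_increment b i x y ib x0 xy; apply.
rewrite -!mulrA ler_wpM2l// [leRHS]mulrA (mulrC _ (y - x)) mulrA ler_pM//.
- by rewrite subr_sqr ?mulr_ge0 ?subr_ge0// addr_ge0// ltW.
- by rewrite tail_moment_ge0// ltW.
- by rewrite subr_sqr ler_wpM2l ?subr_ge0// lerD// (le_trans xy).
- exact: tail_moment_nonincreasing.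
Qed.

Lemma continuous_tail_moment b i x : (i.+1.*2 <= b)%N -> 0 < x ->
  {for x, continuous (tail_moment b i.+1)}.
Proof.
move=> ib x0; have x20 : 0 < x / 2 by rewrite divr_gt0.
apply: (lipschitz_on_continuous (@lipschitz_on_tail_moment b i _ (x + 1) ib x20)).
  by rewrite ltr_pdivrMr// ltr_pMr// ltr1n.
by rewrite ltrDl.
Qed.

(** The difference quotient at x lies between -(i+1) (2x + h) K_i(x) and
    -(i+1) (2x + h) K_i(x + h), in an order that depends on the sign of h; both
    bounds tend to the announced value when K_i is continuous at x. *)
Lemma is_derive_tail_moment b i x : (i.+1.*2 <= b)%N -> 0 < x ->
  {for x, continuous (tail_moment b i)} ->
  is_derive x 1 (tail_moment b i.+1) (- (2 * i.+1%:R * x * tail_moment b i x)).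
Proof.
move=> ib x0 cK; set K1 := tail_moment b i.+1; set K0 := tail_moment b i.
set l := - _.
(* The two bounds for the difference quotient. *)
pose A h := - (i.+1%:R * (h + x + x) * K0 x).
pose B h := - (i.+1%:R * (h + x + x) * K0 (h + x)).
have hx : (fun h => h + x) @ (0 : R) --> x.
  by rewrite -[X in _ --> X]add0r; apply: cvgD; [exact: cvg_id|exact: cvg_cst].
have hxx : (fun h => i.+1%:R * (h + x + x)) @ (0 : R) --> i.+1%:R * (x + x).
  by apply: cvgM; [exact: cvg_cst|apply: cvgD; [exact: hx|exact: cvg_cst]].
have lE : l = - (i.+1%:R * (x + x) * K0 x) by rewrite /l /K0; ring.
have cA : A h @[h --> (0 : R)^'] --> l.
  rewrite lE; apply: cvg_trans; first exact: cvg_within_filter.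
  by apply: cvgN; apply: cvgM => //; exact: cvg_cst.
have cB : B h @[h --> (0 : R)^'] --> l.
  rewrite lE; apply: cvg_trans; first exact: cvg_within_filter.
  apply: cvgN; apply: cvgM => //.
  apply: (@cvg_comp _ _ _ (fun h => h + x) K0 _ _ _ hx); exact: cK.
have qAB : \forall h \near (0 : R)^', let q := h^-1 *: (K1 (h *: 1 + x) - K1 x) in
    Num.min (A h) (B h) <= q <= Num.max (A h) (B h).
  near=> h; rewrite /=.
  have h0 : h != 0 by near: h; exact: nbhs_dnbhs_neq.
  have hx0 : 0 < h + x.
    rewrite -(opprK x) subr_gt0; near: h; apply: nbhs_dnbhs; apply: lt_nbhsr.
    by rewrite oppr_lt0.
  rewrite /GRing.scale/= mulr1 ge_min le_max.
  have sq : (h + x) ^+ 2 - x ^+ 2 = h * (h + x + x) by ring.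
  have sq' : x ^+ 2 - (h + x) ^+ 2 = - h * (h + x + x) by ring.
  have [hp|hn] := ltP 0 h.
    have xh : x <= h + x by rewrite lerDr ltW.
    have /andP[lo up] := @tail_moment_increment b i x (h + x) ib x0 xh.
    rewrite -/K1 -/K0 sq in lo up.
    apply/andP; split; apply/orP; [left|right].
      rewrite /A (mulrC h^-1) ler_pdivlMr// -lerN2 opprB (le_trans up)// -/K0.
      by rewrite le_eqVlt; apply/orP; left; apply/eqP; ring.
    rewrite /B (mulrC h^-1) ler_pdivrMr// -lerN2 opprB (le_trans _ lo)// -/K0.
    by rewrite le_eqVlt; apply/orP; left; apply/eqP; ring.
  have hn' : h < 0 by rewrite lt_neqAle h0.
  have xh : h + x <= x by rewrite gerDr.
  have /andP[lo up] := @tail_moment_increment b i (h + x) x ib hx0 xh.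
  rewrite -/K1 -/K0 sq' in lo up.
  apply/andP; split; apply/orP; [right|left].
    rewrite /B (mulrC h^-1) ler_ndivlMr// (le_trans up)// -/K0.
    by rewrite le_eqVlt; apply/orP; left; apply/eqP; ring.
  rewrite /A (mulrC h^-1) ler_ndivrMr// (le_trans _ lo)// -/K0.
  by rewrite le_eqVlt; apply/orP; left; apply/eqP; ring.
have cq : h^-1 *: (K1 (h *: 1 + x) - K1 x) @[h --> (0 : R)^'] --> l.
  apply/cvgrPdist_le => e e0; near=> h.
  have /andP[] : Num.min (A h) (B h) <= h^-1 *: (K1 (h *: 1 + x) - K1 x)
      <= Num.max (A h) (B h) by near: h.
  have : `|l - A h| <= e by near: h; apply: cvgr_dist_le.
  have : `|l - B h| <= e by near: h; apply: cvgr_dist_le.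
  rewrite !ler_norml ge_min le_max.
  move=> /andP[? ?] /andP[? ?] /orP[?|?] /orP[?|?]; apply/andP; split; lra.
apply: DeriveDef; first by apply/cvg_ex; exists l.
exact/cvg_lim.
Unshelve. all: by end_near. Qed.

(** For i = 0 the only modulus of continuity available is the mass that nu gives
    to the interval. *)
Lemma tail_moment0_increment b a x y : 0 < a -> a <= x -> x <= y ->
  tail_moment b 0 x - tail_moment b 0 y <= a ^- b * fine (nu `]x, y]%classic).
Proof.
move=> a0 ax xy; have x0 := lt_le_trans a0 ax; have y0 := lt_le_trans x0 xy.
have mxy : measurable (`]x, y]%classic : set (measurableTypeR R)).
  exact: measurable_itv.
have -> : fine (nu `]x, y]%classic) = \int[nu]_u \1_(`]x, y]%classic) u.
  by rewrite /Rintegral integral_indic// setIT.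
have int1 : nu.-integrable setT (EFin \o \1_(`]x, y]%classic)).
  by apply: integrable_indic => //; rewrite setIT -ge0_fin_numE// fin_num_measure.
rewrite -RintegralB//; [|exact: integrable_tail_kernel..].
rewrite -RintegralZl//; apply: le_Rintegral => //.
- under [X in integrable _ _ X]eq_fun do rewrite /= EFinB.
  by apply: integrableB => //; exact: integrable_tail_kernel.
- under [X in integrable _ _ X]eq_fun do rewrite /= EFinM.
  exact: integrableZl.
move=> u _; rewrite indicE /tail_kernel !expr0.
have ab0 : 0 <= a ^- b by rewrite invr_ge0 exprn_ge0// ltW.
have [xu|ux] := ltP x u; last first.
  by rewrite ltNge (le_trans ux xy)/= subrr mulr_ge0.
have [yu|uy] := ltP y u; first by rewrite subrr mulr_ge0.
rewrite mem_set/= ?in_itv/= ?xu// subr0 mulr1 mul1r.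
have u0 := lt_trans x0 xu.
rewrite lef_pV2 ?posrE ?exprn_gt0// lerXn2r// ?nnegrE ?ltW//.
exact: le_lt_trans ax xu.
Qed.

Lemma continuous_tail_moment0 b x : 0 < x -> nu [set x] = 0%E ->
  {for x, continuous (tail_moment b 0)}.
Proof.
move=> x0 nux.
pose F n := `]x - n.+1%:R^-1, x + n.+1%:R^-1]%classic : set (measurableTypeR R).
have mF n : measurable (F n) by exact: measurable_itv.
have Fx : \bigcap_n F n = [set x].
  apply/seteqP; split => [y Fy|y -> n _]; last first.
    by rewrite /F/= in_itv/= ltrBlDr ltrDl invr_gt0 ltr0Sn lerDl invr_ge0 ler0n.
  apply: contrapT => /eqP yx.
  have d0 : 0 < `|y - x| by rewrite normr_gt0 subr_eq0.
  have [N _ /(_ _ (leqnn N))/= Nd] := near_infty_natSinv_lt (PosNum d0).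
  have := Fy N I; rewrite /F/= in_itv/= => /andP[y1 y2].
  by move: Nd; apply/negP; rewrite -leNgt ler_norml lerBlDr lerBrDr addrC (ltW y1) addrC y2.
have cF : nu \o F @ \oo --> nu [set x].
  rewrite -Fx; apply: nonincreasing_cvg_mu => //.
  - by rewrite -ge0_fin_numE// fin_num_measure.
  - by rewrite Fx.
  - move=> m n mn; apply/subsetPset => y; rewrite /F/= !in_itv/=.
    have : n.+1%:R^-1 <= m.+1%:R^-1 :> R by rewrite lef_pV2 ?posrE// ler_nat.
    by move=> H /andP[y1 y2]; rewrite (le_lt_trans _ y1) ?lerB// (le_trans y2)// lerD2l.
rewrite nux in cF.
have x20 : 0 < x / 2 by rewrite divr_gt0.
have C0 : 0 < (x / 2) ^- b by rewrite invr_gt0 exprn_gt0.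
apply/cvgrPdist_le => e e0.
have eC : 0 < e / (x / 2) ^- b by rewrite divr_gt0.
have : \forall n \near \oo, fine (nu (F n)) <= e / (x / 2) ^- b.
  have /fine_cvgP[_] := cF => /cvgrPdist_le/(_ _ eC).
  apply: filterS => n /=; rewrite sub0r normrN; apply: le_trans; exact: ler_norm.
move=> [n _ /(_ _ (leqnn n))/= nF].
have inF y z : x - n.+1%:R^-1 <= y -> z <= x + n.+1%:R^-1 ->
    x / 2 <= y -> y <= z -> 
    `|tail_moment b 0 y - tail_moment b 0 z| <= e.
  move=> yl zr y2 yz; rewrite ger0_norm; last first.
    by rewrite subr_ge0 tail_moment_nonincreasing// (lt_le_trans x20).
  apply: (le_trans (tail_moment0_increment _ x20 y2 yz)).
  rewrite mulrC -ler_pdivlMr//; apply: (le_trans _ nF).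
  have myz : measurable (`]y, z]%classic : set (measurableTypeR R)).
    exact: measurable_itv.
  apply: fine_le; rewrite ?fin_num_measure//.
  apply: le_measure; rewrite ?inE//.
  move=> u/=; rewrite /F/= !in_itv/= => /andP[yu uz].
  by rewrite (le_lt_trans yl)//= (le_trans uz).
have x2x : x / 2 < x by rewrite ltr_pdivrMr// ltr_pMr// ltr1n.
have n0 : 0 < n.+1%:R^-1 :> R by rewrite invr_gt0.
near=> y; have [xy|yx] := leP x y.
  apply: inF; rewrite ?gerBl ?(ltW n0)// ?(ltW x2x)//.
  by apply: ltW; near: y; apply: lt_nbhsl; rewrite ltrDl.
rewrite distrC; apply: inF; rewrite ?lerDl ?(ltW n0)//; last exact: ltW.
- by apply: ltW; near: y; apply: lt_nbhsr; rewrite gtrBl.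
- by apply: ltW; near: y; apply: lt_nbhsr.
Unshelve. all: by end_near. Qed.

End tail_moment.

(** * Iterated derivatives as combinations of tail moments *)

Section derive_helpers.
Context {R : realType}.
Implicit Types (x : R) (f g : R -> R).

Lemma is_derive1_expr n x :
  is_derive x 1 (fun y : R => y ^+ n) (n%:R * x ^+ n.-1).
Proof.
have := @is_deriveX R R id n x 1 1 (is_derive_id _ _).
by rewrite /GRing.scale/= mulr1 (_ : id ^+ n = fun y : R => y ^+ n)// exprfctE.
Qed.

Lemma is_derive1_exprV n x : x != 0 ->
  is_derive x 1 (fun y : R => y ^- n) (- (n%:R * x ^- n.+1)).
Proof.
move=> x0; have xn0 : x ^+ n != 0 by rewrite expf_neq0.
have := @is_deriveV R _ x _ 1 xn0 (is_derive1_expr n x).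
move=> dh; apply: (is_derive_eq dh); rewrite /GRing.scale/=.
case: n xn0 {dh} => [|n] xn0; first by rewrite !mul0r oppr0 mulr0.
by rewrite /= !exprS; field; rewrite x0 expf_neq0.
Qed.

Lemma derive1n_ext_pos f g k : {in `]0, +oo[, f =1 g} ->
  {in `]0, +oo[, derive1n k f =1 derive1n k g}.
Proof.
move=> fg; elim: k => [|k ih] x x0; first exact: fg.
rewrite !derive1nS !derive1E; apply: near_eq_derive; near=> y; apply: ih.
rewrite in_itv/= andbT; near: y; apply: lt_nbhsr.
by move: x0; rewrite in_itv/= andbT.
Unshelve. all: by end_near. Qed.

Lemma near_pos x : 0 < x -> \forall y \near x, 0 < y.
Proof. exact: lt_nbhsr. Qed.

End derive_helpers.

Section euler_moments.
Context {R : realType} (nu : probability (measurableTypeR R) R) (m J : nat).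
Implicit Types (r k : nat) (x : R).

Notation K := (tail_moment nu (m + J.*2)).

(** The function T_r; the powers of x and u have total degree -1, which makes
    all T_r comparable to the same tail integral of 1/u. *)
Definition scaled_moment r x : R := x ^+ (m.-1 + r.*2) * K (J - r) x.

(** The coefficients of x^k p^(k) on the T_r.  The recursion in k encodes
    x^(k+1) d^(k+1) = (x d/dx - k) x^k d^k together with the action of x d/dx on
    the T_r. *)
Fixpoint euler_coef (c : R) k r : R :=
  if k is k'.+1 then
    ((m.-1 + r.*2)%:R - k'%:R) * euler_coef c k' r -
    (if r is s.+1 then 2 * (J - s)%:R * euler_coef c k' s else 0)
  else if r is 0 then c else 0.

Lemma euler_coef_gt c k r : (k < r)%N -> euler_coef c k r = 0.
Proof.
elim: k r => [[]//|k ih] [//|r] kr /=.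
by rewrite !ih ?mulr0 ?subr0// ltnW.
Qed.

Definition euler_sum c k x : R :=
  \sum_(r < k.+1) euler_coef c k r * scaled_moment r x.

Lemma is_derive_scaled_moment r x : (r < J)%N -> 0 < x ->
  (r.+1 = J -> {for x, continuous (K 0)}) ->
  is_derive x 1 (scaled_moment r) (x^-1 *
    ((m.-1 + r.*2)%:R * scaled_moment r x -
     2 * (J - r)%:R * scaled_moment r.+1 x)).
Proof.
move=> rJ x0 cK.
have JrE : (J - r)%N = (J - r.+1).+1 by rewrite -subSn.
have cK1 : {for x, continuous (K (J - r.+1))}.
  have [rJ'|Jr] := ltnP r.+1 J; last first.
    have rE : r.+1 = J by apply/eqP; rewrite eqn_leq rJ.
    by rewrite rE subnn; exact: cK.
  rewrite (_ : (J - r.+1)%N = (J - r.+2).+1)//; last by rewrite -subSn.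
  apply: continuous_tail_moment => //.
  by rewrite -subSn// subSS (leq_trans _ (leq_addl _ _))// leq_double leq_subr.
have dK : is_derive x 1 (K (J - r)) (- (2 * (J - r)%:R * x * K (J - r.+1) x)).
  rewrite JrE; apply: is_derive_tail_moment => //.
  by rewrite -JrE (leq_trans _ (leq_addl _ _))// leq_double leq_subr.
have := is_deriveM (is_derive1_expr (m.-1 + r.*2) x) dK.
move=> dh; apply: (is_derive_eq dh); rewrite /scaled_moment /GRing.scale/=.
rewrite doubleS !addnS !exprS.
case: (m.-1 + r.*2)%N => [|e] /=.
  by field; rewrite gt_eqF.
by rewrite exprS; field; rewrite gt_eqF.
Qed.

Lemma is_derive_euler_sum c k x : (k < J)%N -> 0 < x ->
  (k.+1 = J -> {for x, continuous (K 0)}) ->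
  is_derive x 1 (fun y => y ^- k * euler_sum c k y)
                (x ^- k.+1 * euler_sum c k.+1 x).
Proof.
move=> kJ x0 cK; have xn0 : x != 0 by rewrite gt_eqF.
have dT (r : 'I_k.+1) : is_derive x 1 (euler_coef c k r \*: scaled_moment r)
    (euler_coef c k r *: (x^-1 *
    ((m.-1 + r.*2)%:R * scaled_moment r x -
     2 * (J - r)%:R * scaled_moment r.+1 x))).
  apply: is_deriveZ; apply: is_derive_scaled_moment => //.
    by apply: leq_ltn_trans kJ; rewrite -ltnS.
  move=> rJ; apply: cK; apply/eqP; rewrite eqn_leq kJ -rJ.
  exact: ltn_ord.
have := is_deriveM (is_derive1_exprV k xn0) (is_derive_sum dT).
rewrite (_ : (fun y => y ^- k) * _ = fun y => y ^- k * euler_sum c k y); last first.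
  apply/funext => y; rewrite /euler_sum [LHS]/GRing.mul/=; congr (_ * _).
  by rewrite fct_sumE.
move=> dh; apply: (is_derive_eq dh); rewrite /GRing.scale/=.
have -> : (\sum_(i < k.+1) euler_coef c k i \*: scaled_moment i) x = euler_sum c k x.
  by rewrite /euler_sum fct_sumE.
have -> : \sum_(i < k.+1) euler_coef c k i * (x^-1 *
       ((m.-1 + i.*2)%:R * scaled_moment i x -
        2 * (J - i)%:R * scaled_moment i.+1 x)) =
    x^-1 * (\sum_(i < k.+1) (m.-1 + i.*2)%:R * euler_coef c k i * scaled_moment i x
      - \sum_(i < k.+1) 2 * (J - i)%:R * euler_coef c k i * scaled_moment i.+1 x).
  rewrite -sumrB mulr_sumr; apply: eq_bigr => i _; ring.
have -> : euler_sum c k.+1 x =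
    \sum_(i < k.+1) (m.-1 + i.*2)%:R * euler_coef c k i * scaled_moment i x
    - k%:R * euler_sum c k x
    - \sum_(i < k.+1) 2 * (J - i)%:R * euler_coef c k i * scaled_moment i.+1 x.
  transitivity (
      \sum_(i < k.+2)
        (((m.-1 + i.*2)%:R - k%:R) * euler_coef c k i) * scaled_moment i x -
      \sum_(i < k.+2)
        (if (i : nat) is s.+1 then 2 * (J - s)%:R * euler_coef c k s else 0) *
        scaled_moment i x).
    by rewrite -sumrB /euler_sum; apply: eq_bigr => i _; rewrite -mulrBl.
  rewrite big_ord_recr/= euler_coef_gt// mulr0 mul0r addr0.
  (* The sum on r with the index shifted by one starts with a null term. *)
  rewrite [X in _ - X]big_ord_recl/= mul0r add0r; congr (_ - _).
  rewrite /euler_sum mulr_sumr -sumrB; apply: eq_bigr => i _; ring.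
rewrite exprS; field.
by rewrite xn0 expf_neq0.
Qed.

(** The formula of order k + 1 at a single point x is deduced from the formula of
    order k near x, so continuity of K_0 is needed only at x itself and only for
    the last order: this is what makes the statement usable in the presence of
    atoms. *)
Lemma derive1n_euler_sum (p : R -> R) c :
  (forall x, 0 < x -> p x = c * scaled_moment 0 x) ->
  forall k, (k <= J)%N -> forall x, 0 < x ->
  (k = J -> {for x, continuous (K 0)}) ->
  derive1n k p x = x ^- k * euler_sum c k x.
Proof.
move=> pE; elim=> [|k ih] kJ x x0 cK.
  by rewrite /= expr0 invr1 mul1r /euler_sum big_ord1 pE.
rewrite derive1nS derive1E.
have := is_derive_euler_sum c kJ x0 cK => /(@derive_val _ _ _ _ _ _ _) <-.
apply: near_eq_derive; near=> y; apply: ih.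
- exact: ltnW.
- by near: y; exact: near_pos.
- by move=> kJ'; move: kJ; rewrite kJ' ltnn.
Unshelve. all: by end_near. Qed.

Lemma derivable_derive1n (p : R -> R) c :
  (forall x, 0 < x -> p x = c * scaled_moment 0 x) ->
  forall k, (k < J)%N -> forall x, 0 < x ->
  (k.+1 = J -> {for x, continuous (K 0)}) ->
  derivable (derive1n k p) x 1.
Proof.
move=> pE k kJ x x0 cK.
have [dE _] := is_derive_euler_sum c kJ x0 cK.
apply: near_eq_derivable dE; near=> y; apply/esym.
apply: (derive1n_euler_sum pE).
- exact: ltnW.
- by near: y; exact: near_pos.
- by move=> kJ'; move: kJ; rewrite kJ' ltnn.
Unshelve. all: by end_near. Qed.

End euler_moments.

Section lipschitz_derivatives.
Context {R : realType} (nu : probability (measurableTypeR R) R) (m J : nat).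

(** For k < J only tail moments K_i with i > 0 occur. *)
Lemma lipschitz_on_euler_sum (q : R) k (a b : R) : (k < J)%N -> 0 < a ->
  lipschitz_on a b (fun x => x ^- k * euler_sum nu m J q k x).
Proof.
move=> kJ a0; apply: lipschitz_onM; first exact: lipschitz_on_exprV.
apply: lipschitz_on_sum => r; apply: lipschitz_onM; first exact: lipschitz_on_const.
apply: lipschitz_onM; first exact: lipschitz_on_expr.
have rJ : (r < J)%N by apply: leq_ltn_trans kJ; rewrite -ltnS.
rewrite (_ : (J - r)%N = (J - r.+1).+1); last by rewrite -subSn.
apply: lipschitz_on_tail_moment => //.
by rewrite -subSn// subSS (leq_trans _ (leq_addl _ _))// leq_double leq_subr.
Qed.

End lipschitz_derivatives.

(** * Estimates and limits of the scaled tail moments *)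

Section measurability.
Context {R : realType} (nu : probability (measurableTypeR R) R).

(** Tail moments are monotone only on the open half-line, where they may be
    unbounded near 0; the preimage of a ray is still an interval. *)
Lemma nonincreasing_in_measurable (D : set R) (f : R -> R) : is_interval D ->
  {in D &, nonincreasing_fun f} ->
  measurable_fun (D : set (measurableTypeR R)) f.
Proof.
move=> iD fni _.
have mD : measurable (D : set (measurableTypeR R)) by exact: is_interval_measurable.
apply: (measurability (@RGenCInfty.G R)) => // [|/= _ [_] [r] -> <-].
  exact: RGenCInfty.measurableE.
apply: is_interval_measurable => s t/=.
rewrite !in_itv/= !andbT => -[Ds fs] [Dt ft] u /andP[su ut].
have Du : D u by apply: (iD s t) => //; rewrite su ut.
by split => //; rewrite in_itv/= andbT (le_trans ft)// fni ?inE.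
Qed.

Lemma measurable_tail_moment b i : (i.*2 <= b)%N ->
  measurable_fun (`]0, +oo[%classic : set (measurableTypeR R)) (tail_moment nu b i).
Proof.
move=> ib; apply: nonincreasing_in_measurable; first exact: interval_is_interval.
move=> x y; rewrite !inE/= !in_itv/= !andbT => x0 y0 xy.
exact: tail_moment_nonincreasing.
Qed.

Lemma measurable_euler_sum m J c k : (k <= J)%N ->
  measurable_fun (`]0, +oo[%classic : set (measurableTypeR R)) (euler_sum nu m J c k).
Proof.
move=> kJ; apply: (@measurable_sum _ _ _ _ _ _ (fun (r : 'I_k.+1) x =>
  euler_coef m J c k r * scaled_moment nu m J r x)) => r.
apply: measurable_funM => //; apply: measurable_funM.
  by apply: measurable_funX; exact: measurable_id.
apply: measurable_tail_moment.
by rewrite (leq_trans _ (leq_addl _ _))// leq_double leq_subr.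
Qed.

End measurability.

Section bounds.
Context {R : realType} (nu : probability (measurableTypeR R) R) (m J : nat).
Hypothesis m0 : (0 < m)%N.
Implicit Types (r k : nat) (x u : R).

Lemma tail_kernel10_eq x u : tail_kernel 1 0 x u = if x < u then u^-1 else 0.
Proof. by rewrite /tail_kernel; case: ltP => // _; rewrite expr0 expr1 mul1r. Qed.

(** Since x < u, each factor x may be replaced by u and u^2 - x^2 by u^2; the
    exponents then add up to m - 1 + 2 J, one less than in the denominator. *)
Lemma scaled_kernel_ge0_le r x u : 0 <= x -> (r <= J)%N ->
  0 <= x ^+ (m.-1 + r.*2) * tail_kernel (m + J.*2) (J - r) x u
    <= tail_kernel 1 0 x u.
Proof.
move=> x0 rJ; rewrite mulr_ge0 ?exprn_ge0 ?tail_kernel_ge0//=.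
rewrite tail_kernel10_eq /tail_kernel; case: ltP => xu; last by rewrite mulr0.
have u0 : 0 < u := le_lt_trans x0 xu.
have -> : u^-1 = u ^+ (m.-1 + r.*2) * ((u ^+ 2) ^+ (J - r) / u ^+ (m + J.*2)).
  rewrite -exprM mul2n doubleB mulrA -exprD.
  have -> : (m.-1 + r.*2 + (J.*2 - r.*2) = m.-1 + J.*2)%N.
    by rewrite -addnA subnKC// leq_double.
  have -> : (m + J.*2 = (m.-1 + J.*2).+1)%N by rewrite -addSn prednK.
  by rewrite exprS invfM mulrCA mulfV ?mulr1// expf_neq0// gt_eqF.
rewrite ler_pM ?exprn_ge0//.
- by rewrite divr_ge0 ?exprn_ge0 ?subr_sqr_ge0// ltW.
- by rewrite lerXn2r ?nnegrE// ltW.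
rewrite ler_wpM2r ?invr_ge0 ?exprn_ge0 ?(ltW u0)//.
by rewrite lerXn2r ?nnegrE ?subr_sqr_ge0 ?exprn_ge0 ?(ltW u0)// gerBl sqr_ge0.
Qed.

Lemma scaled_momentE r x : 0 < x -> (r <= J)%N -> scaled_moment nu m J r x =
  \int[nu]_u (x ^+ (m.-1 + r.*2) * tail_kernel (m + J.*2) (J - r) x u).
Proof.
move=> x0 rJ; rewrite /scaled_moment RintegralZl//; apply: integrable_tail_kernel => //.
by rewrite (leq_trans _ (leq_addl _ _))// leq_double leq_subr.
Qed.

Lemma scaled_moment_bounds r x : 0 < x -> (r <= J)%N ->
  0 <= scaled_moment nu m J r x <= tail_moment nu 1 0 x.
Proof.
move=> x0 rJ; rewrite scaled_momentE//; apply/andP; split.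
  by apply: Rintegral_ge0 => u _; have /andP[] := scaled_kernel_ge0_le u (ltW x0) rJ.
apply: le_Rintegral => //.
- under [X in integrable _ _ X]eq_fun do rewrite /= EFinM.
  apply: integrableZl => //; apply: integrable_tail_kernel => //.
  by rewrite (leq_trans _ (leq_addl _ _))// leq_double leq_subr.
- exact: integrable_tail_kernel.
- by move=> u _; have /andP[] := scaled_kernel_ge0_le u (ltW x0) rJ.
Qed.

Lemma euler_sum_le c k x : 0 < x -> (k <= J)%N ->
  `|euler_sum nu m J c k x| <=
    (\sum_(r < k.+1) `|euler_coef m J c k r|) * tail_moment nu 1 0 x.
Proof.
move=> x0 kJ; apply: (le_trans (ler_norm_sum _ _ _)).
rewrite mulr_suml; apply: ler_sum => r _; rewrite normrM ler_wpM2l//.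
have rJ : (r <= J)%N by apply: leq_trans kJ; rewrite -ltnS.
by have /andP[? ?] := scaled_moment_bounds x0 rJ; rewrite ger0_norm.
Qed.

(** Markov-type bound behind the decay of the derivatives at infinity. *)
Lemma tail_moment10_le_tail_measure x : 0 < x ->
  x * tail_moment nu 1 0 x <= fine (nu `]x, +oo[%classic).
Proof.
move=> x0; have mx : measurable (`]x, +oo[%classic : set (measurableTypeR R)).
  exact: measurable_itv.
have -> : fine (nu `]x, +oo[%classic) = \int[nu]_u \1_(`]x, +oo[%classic) u.
  by rewrite /Rintegral integral_indic// setIT.
rewrite /tail_moment -RintegralZl//; last exact: integrable_tail_kernel.
apply: le_Rintegral => //.
- under [X in integrable _ _ X]eq_fun do rewrite /= EFinM.
  by apply: integrableZl => //; exact: integrable_tail_kernel.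
- exact: integrable_indic.
move=> u _; rewrite tail_kernel10_eq indicE; case: ltP => xu; last first.
  by rewrite mulr0 ler0n.
rewrite mem_set/= ?in_itv/= ?xu//.
by rewrite ler_pdivrMr ?mul1r ?(ltW xu)// (lt_trans x0).
Qed.

Lemma tail_measure_cvg0 : fine (nu `]x, +oo[%classic) @[x --> +oo] --> (0 : R).
Proof.
pose F n := `]n%:R, +oo[%classic : set (measurableTypeR R).
have F0 : \bigcap_n F n = set0.
  apply/seteqP; split => // y Fy.
  have := Fy (Num.truncn `|y|).+1 I.
  rewrite /F/= in_itv/= andbT => ty.
  have := truncnS_gt `|y|; rewrite ltNge => /negP; apply.
  by apply: (le_trans (ltW ty)); exact: ler_norm.
have cF : nu \o F @ \oo --> nu set0.
  rewrite -F0; apply: nonincreasing_cvg_mu => //.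
  - by rewrite -ge0_fin_numE// fin_num_measure//; exact: measurable_itv.
  - by move=> n; exact: measurable_itv.
  - by rewrite F0.
  - move=> a b ab; apply/subsetPset => y; rewrite /F/= !in_itv/= !andbT.
    by apply: le_lt_trans; rewrite ler_nat.
rewrite measure0 in cF.
apply/cvgrPdist_le => e e0.
have /fine_cvgP[_] := cF => /cvgrPdist_le/(_ _ e0)[n _ /(_ _ (leqnn n))/=].
rewrite sub0r normrN => nF.
near=> x; rewrite sub0r normrN ger0_norm ?fine_ge0//.
apply: le_trans (le_trans (ler_norm _) nF).
have mI z : measurable (`]z, +oo[%classic : set (measurableTypeR R)).
  exact: measurable_itv.
apply: fine_le; rewrite ?fin_num_measure//; try exact: mI.
apply: le_measure; rewrite ?inE//; try exact: mI.
move=> u; rewrite /F/= !in_itv/= !andbT; apply: le_lt_trans.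
by near: x; apply: nbhs_pinfty_ge; rewrite num_real.
Unshelve. all: by end_near. Qed.

Lemma schoenberg_densityE x : 0 <= x ->
  schoenberg_density m J.+1 nu x =
  2 / Beta (m%:R / 2) J.+1%:R * scaled_moment nu m J 0 x.
Proof.
move=> x0; rewrite /schoenberg_density /scaled_moment addn0 subn0 /=.
rewrite (mulrAC 2) -!mulrA; congr (_ * (_ * (_ * _))).
rewrite /tail_moment [LHS]Rintegral_mkcond; apply: eq_Rintegral => u _.
rewrite patchE /tail_kernel; case: ltP => xu; last first.
  by rewrite memNset//= in_itv/= andbT; apply/negP; rewrite -leNgt.
rewrite mem_set/= ?in_itv/= ?xu//.
have u0 : u != 0 by rewrite gt_eqF// (le_lt_trans x0).
have -> : 1 - x ^+ 2 / u ^+ 2 = (u ^+ 2 - x ^+ 2) / u ^+ 2.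
  by rewrite mulrBl divff// expf_neq0.
by rewrite expr_div_n exprD -mul2n exprM -mulrA -invfM (mulrC (u ^+ m)).
Qed.

Hypothesis int10 : (\int[nu]_(u in `]0%R, +oo[) (u^-1)%:E < +oo)%E.

Lemma integrable_tail_kernel10 : nu.-integrable setT (EFin \o tail_kernel 1 0 0).
Proof.
apply/integrableP; split.
  by apply/measurable_EFinP; exact: measurable_tail_kernel.
rewrite (_ : \int[nu]_x _ = \int[nu]_(u in `]0%R, +oo[) (u^-1)%:E)%E//.
rewrite [RHS]integral_mkcond; apply: eq_integral => u _.
rewrite patchE /comp tail_kernel10_eq; case: ltP => u0; last first.
  by rewrite abse0 memNset//= in_itv/= andbT; apply/negP; rewrite -leNgt.
by rewrite mem_set/= ?in_itv/= ?u0// ger0_norm// invr_ge0 ltW.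
Qed.

Lemma tail_moment10_0 : tail_moment nu 1 0 0 = \int[nu]_(u in `]0%R, +oo[) u^-1.
Proof.
rewrite [RHS]Rintegral_mkcond; apply: eq_Rintegral => u _.
rewrite patchE tail_kernel10_eq; case: ltP => u0.
  by rewrite mem_set/= ?in_itv/= ?u0.
by rewrite memNset//= in_itv/= andbT; apply/negP; rewrite -leNgt.
Qed.

Lemma tail_moment10_le0 x : 0 < x -> tail_moment nu 1 0 x <= tail_moment nu 1 0 0.
Proof.
move=> x0; apply: le_Rintegral => //.
- exact: integrable_tail_kernel.
- exact: integrable_tail_kernel10.
- by move=> u _; apply: tail_kernel_nonincreasing => //; exact: ltW.
Qed.

(** The integrands are dominated by 1/u, and converge to 1/u if m = 1 and to 0 if
    m > 1; the factor 0^(m-1) covers both cases. *)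
Lemma scaled_moment0_cvg0 :
  scaled_moment nu m J 0 x @[x --> 0^'+] --> 0 ^+ m.-1 * tail_moment nu 1 0 0.
Proof.
apply/cvg_at_rightP => x_ [x_gt0 x_cvg].
have -> : 0 ^+ m.-1 * tail_moment nu 1 0 0 = \int[nu]_u (0 ^+ m.-1 * tail_kernel 1 0 0 u).
  by rewrite RintegralZl//; exact: integrable_tail_kernel10.
pose f n u := (x_ n ^+ m.-1 * tail_kernel (m + J.*2) J (x_ n) u)%:E.
have fE n : scaled_moment nu m J 0 (x_ n) = fine (\int[nu]_u f n u)%E.
  by rewrite scaled_momentE// addn0 subn0.
under eq_fun do rewrite fE.
have bnd n u : 0 <= x_ n ^+ m.-1 * tail_kernel (m + J.*2) J (x_ n) u <= tail_kernel 1 0 0 u.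
  have := @scaled_kernel_ge0_le 0 (x_ n) u (ltW (x_gt0 n)) (leq0n _).
  rewrite addn0 subn0 => /andP[-> /le_trans]; apply.
  by apply: tail_kernel_nonincreasing => //; exact: ltW.
have [] := @dominated_convergence _ _ _ nu setT measurableT f
  (fun u => (0 ^+ m.-1 * tail_kernel 1 0 0 u)%:E) (EFin \o tail_kernel 1 0 0).
- move=> n; apply/measurable_EFinP; apply: measurable_funM => //.
  by apply: measurable_tail_kernel; exact: ltW.
- apply/measurable_EFinP; apply: measurable_funM => //.
  exact: measurable_tail_kernel.
- apply: aeW => u _; apply: cvg_EFin; first exact: nearW.
  have [u0|u0] := leP u 0.
    rewrite tail_kernel10_eq ltNge u0/= mulr0 (_ : fine \o _ = cst 0).
      exact: cvg_cst.
    apply/funext => n /=; rewrite /tail_kernel ltNge (le_trans u0)/= ?mulr0//.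
    exact: ltW.
  have -> : 0 ^+ m.-1 * tail_kernel 1 0 0 u =
      0 ^+ m.-1 * ((u ^+ 2 - 0 ^+ 2) ^+ J / u ^+ (m + J.*2)).
    rewrite tail_kernel10_eq u0 (expr0n _ 2) subr0.
    case: m m0 => // -[|m'] _ /=; last by rewrite exprS !mul0r.
    rewrite -exprM mul2n add1n (exprS u J.*2); congr (_ * _); rewrite invfM mulrCA mulfV ?mulr1//.
    by rewrite expf_neq0// gt_eqF.
  apply: cvg_trans (_ : (fun n => x_ n ^+ m.-1 * ((u ^+ 2 - x_ n ^+ 2) ^+ J / u ^+ (m + J.*2))) @ \oo --> _).
    apply: near_eq_cvg; near=> n; rewrite /= /tail_kernel ifT//.
    near: n; exact: (cvgr_lt 0 x_cvg).
  have cX k : x_ n ^+ k @[n --> \oo] --> (0 : R) ^+ k.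
    by apply: (@cvg_comp _ _ _ x_ (fun z => z ^+ k) _ _ _ x_cvg); exact: exprn_continuous.
  apply: cvgM; first exact: cX.
  apply: cvgMl.
  have cB : u ^+ 2 - x_ n ^+ 2 @[n --> \oo] --> (u : R) ^+ 2 - 0 ^+ 2.
    by apply: cvgB; [exact: cvg_cst|exact: cX].
  apply: (@cvg_comp _ _ _ (fun n => u ^+ 2 - x_ n ^+ 2) (fun z => z ^+ J) _ _ _ cB).
  exact: exprn_continuous.
- exact: integrable_tail_kernel10.
- apply: aeW => u n _; rewrite lee_fin.
  by have /andP[? ?] := bnd n u; rewrite ger0_norm.
move=> intl _ fc; apply: fine_cvg; rewrite fineK//.
exact: integrable_fin_num intl.
Unshelve. all: by end_near. Qed.

End bounds.

(** * Integrals of powers *)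

Section power_integrals.
Context {R : realType}.
Notation mu := (@lebesgue_measure R).
Implicit Types (x s e : R).

Lemma is_derive_powR a x : 0 < x ->
  is_derive x 1 (fun u : R => u `^ a) (a * x `^ (a - 1)).
Proof.
move=> x0; have xoo : x \in `]0, +oo[ by rewrite in_itv/= andbT.
apply: DeriveDef; first exact: derivable_powR.
by rewrite -derive1E powR_derive1.
Qed.

Lemma is_derive_powR_primitive a x : a != 0 -> 0 < x ->
  is_derive x 1 (fun u : R => u `^ a / a) (x `^ (a - 1)).
Proof.
move=> a0 x0; have := is_deriveZ a^-1 (is_derive_powR a x0).
rewrite (_ : a^-1 \*: _ = fun u => u `^ a / a); last first.
  by apply/funext => u; rewrite mulrC.
move=> dh; apply: (is_derive_eq dh).
by rewrite /GRing.scale/= mulrA mulVf ?mul1r.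
Qed.

Lemma continuous_powR a x : 0 < x -> {for x, continuous (fun u : R => u `^ a)}.
Proof.
move=> x0; apply: differentiable_continuous; apply/derivable1_diffP.
by apply: ex_derive; exact: is_derive_powR.
Qed.

Lemma cvg_powR_primitive a x : 0 < x ->
  (fun u : R => u `^ a / a) @ x --> x `^ a / a.
Proof. by move=> x0; apply: cvgMl; exact: continuous_powR. Qed.

Lemma powRN_cvgy e : 0 < e -> (fun u : R => u `^ (- e)) @ +oo --> (0 : R).
Proof.
move=> e0; apply/cvgrPdist_le => d d0; near=> u.
have u0 : 0 < u by near: u; apply: nbhs_pinfty_gt; rewrite num_real.
rewrite sub0r normrN ger0_norm ?powR_ge0// powRN.
rewrite -(invrK d) lef_pV2 ?posrE ?powR_gt0// ?invr_gt0//.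
have -> : d^-1 = (d^-1 `^ e^-1) `^ e.
  by rewrite -powRrM mulVf ?gt_eqF// powRr1// invr_ge0 ltW.
apply: ge0_ler_powR; rewrite ?nnegrE ?powR_ge0 ?(ltW e0) ?(ltW u0)//.
Unshelve. all: by end_near. Qed.

Lemma integral_powR_tail_le e x : 0 < e -> 0 < x ->
  (\int[mu]_(u in `]x, +oo[) (u `^ (- e - 1))%:E <= (x `^ (- e) / e)%:E)%E.
Proof.
move=> e0 x0; have ne0 : - e != 0 by rewrite oppr_eq0 gt_eqF.
apply: (@le_trans _ _ (\int[mu]_(u in `[x, +oo[) (u `^ (- e - 1))%:E)%E).
  apply: ge0_subset_integral => //.
  - apply: measurable_funTS; apply/measurable_EFinP; exact: measurable_powR.
  - by move=> u _; rewrite lee_fin powR_ge0.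
  - by apply: subset_itvr; rewrite bnd_simp.
rewrite (@ge0_continuous_FTC2y _ _ (fun u => u `^ (- e) / (- e)) x 0).
- by rewrite sub0e -EFinN invrN mulrN opprK.
- by move=> u _; exact: powR_ge0.
- apply: continuous_in_subspaceT => u; rewrite inE/= in_itv/= andbT => xu.
  by apply: continuous_powR; exact: lt_le_trans xu.
- rewrite -(mul0r (- e)^-1); apply: cvgMl; exact: powRN_cvgy.
- move=> u xu; have u0 := lt_trans x0 xu.
  by apply: ex_derive; exact: is_derive_powR_primitive.
- by apply: cvg_at_right_filter; exact: cvg_powR_primitive.
- move=> u; rewrite in_itv/= andbT => xu; have u0 := lt_trans x0 xu.
  by rewrite derive1E; apply: derive_val; exact: is_derive_powR_primitive.
Qed.

(** The integrand is singular at 0 when e < 1, so the fundamental theorem is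
    applied on compact intervals exhausting the half-open one. *)
Lemma integral_powR_head e s : 0 < e -> 0 < s ->
  (\int[mu]_(u in `]0%R, s[) (u `^ (e - 1))%:E = (s `^ e / e)%:E)%E.
Proof.
move=> e0 s0; have ne0 : e != 0 by rewrite gt_eqF.
have mf D : measurable_fun D (fun u : R => (u `^ (e - 1))%:E).
  apply: measurable_funTS; apply/measurable_EFinP; exact: measurable_powR.
rewrite integral_itv_bndo_bndc//.
pose c n := s / n.+2%:R.
have c0 n : 0 < c n by rewrite divr_gt0.
have cs n : c n < s by rewrite ltr_pdivrMr// ltr_pMr// ltr1n.
pose F n := `[c n, s]%classic : set (measurableTypeR R).
have FE : `]0, s]%classic = \bigcup_n F n.
  apply/seteqP; split => u; rewrite /F/= in_itv/=.
    move=> /andP[u0 us]; exists (Num.truncn (s / u)) => //=.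
    rewrite in_itv/= us andbT ler_pdivrMr// mulrC -ler_pdivrMr//.
    by apply: ltW; apply: (lt_trans (truncnS_gt _)); rewrite ltr_nat.
  by move=> [n _]; rewrite /= in_itv/= => /andP[cu ->]; rewrite (lt_le_trans (c0 n)).
have IF n : (\int[mu]_(u in F n) (u `^ (e - 1))%:E = (s `^ e / e - c n `^ e / e)%:E)%E.
  rewrite /F (@continuous_FTC2 _ _ (fun u => u `^ e / e))//.
  - apply: continuous_in_subspaceT => u; rewrite inE/= in_itv/= => /andP[cu _].
    by apply: continuous_powR; exact: lt_le_trans cu.
  - split.
    + move=> u; rewrite in_itv/= => /andP[cu _].
      by apply: ex_derive; apply: is_derive_powR_primitive => //; exact: lt_trans cu.
    + by apply: cvg_at_right_filter; exact: cvg_powR_primitive.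
    + by apply: cvg_at_left_filter; exact: cvg_powR_primitive.
  - move=> u; rewrite in_itv/= => /andP[cu _]; rewrite derive1E; apply: derive_val.
    by apply: is_derive_powR_primitive => //; exact: lt_trans cu.
rewrite FE.
have cF : (\int[mu]_(u in F n) (u `^ (e - 1))%:E @[n --> \oo] -->
    \int[mu]_(u in \bigcup_n F n) (u `^ (e - 1))%:E)%E.
  apply: ge0_nondecreasing_set_cvg_integral => //.
  - move=> a b ab; apply/subsetPset/subset_itvr; rewrite bnd_simp.
    by rewrite ler_pM2l// lef_pV2 ?posrE// ler_nat.
  - by move=> n; exact: measurable_itv.
  - by move=> n; exact: mf.
  - by move=> n u _; rewrite lee_fin powR_ge0.
rewrite -(cvg_lim _ cF)//; apply: cvg_lim => //.
under eq_fun do rewrite IF; apply: cvg_EFin; first exact: nearW.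
rewrite [X in _ --> X](_ : _ = s `^ e / e - 0 / e); last by rewrite mul0r subr0.
apply: cvgB; first exact: cvg_cst.
apply: cvgMl.
have /cvg_at_rightP := powR_cvg0 e0; apply; split => //.
rewrite -(mulr0 s); apply: cvgMr.
have := @cvg_harmonic R; rewrite -cvg_shiftS; exact.
Qed.

End power_integrals.

(** * The dual Hardy inequality *)

Section tonelli_triangle.
Context {R : realType}.
Notation mu := (@lebesgue_measure R).
Variables (a b : R -> R).
Hypotheses (ma : measurable_fun [set: measurableTypeR R] a)
  (mb : measurable_fun [set: measurableTypeR R] b)
  (a0 : forall x, 0 <= a x) (b0 : forall x, 0 <= b x).

(** Both iterated integrals in the exchange below are integrals of this function
    on the plane, supported by the triangle 0 < x < u. *)
Let G (z : measurableTypeR R * measurableTypeR R) : \bar R :=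
  (if (0 < z.1) && (z.1 < z.2) then a z.1 * b z.2 else 0)%:E.

Let mG : measurable_fun setT G.
Proof.
apply/measurable_EFinP; apply: measurable_fun_ifT => //=.
- by apply: measurable_and; apply: measurable_fun_ltr.
- by apply: measurable_funM; exact: measurableT_comp.
Qed.

Let G0 z : (0 <= G z)%E.
Proof. by rewrite lee_fin; case: ifP => // _; exact: mulr_ge0. Qed.

Let G_section (x : R) : 0 < x ->
  (\int[mu]_u G (x, u) = \int[mu]_(u in `]x, +oo[) (a x * b u)%:E)%E.
Proof.
move=> x0; rewrite [RHS]integral_mkcond; apply: eq_integral => u _.
rewrite patchE /G/= x0/=.
case: ifPn => xu; case: ifPn => //; first by rewrite notin_setE/= in_itv/= xu.
by rewrite inE/= in_itv/= andbT (negbTE xu).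
Qed.

Lemma measurable_tail_integral : measurable_fun (`]0, +oo[%classic : set (measurableTypeR R))
  (fun x => \int[mu]_(u in `]x, +oo[) (a x * b u)%:E)%E.
Proof.
apply: (@eq_measurable_fun _ _ _ _ _ (fun x => \int[mu]_u G (x, u))%E).
  by move=> x; rewrite inE/= in_itv/= andbT => x0; rewrite G_section.
apply: measurable_funTS; exact: (measurable_fun_fubini_tonelli_F G).
Qed.

Lemma tonelli_triangle :
  (\int[mu]_(x in `]0%R, +oo[) \int[mu]_(u in `]x, +oo[) (a x * b u)%:E =
   \int[mu]_(u in `]0%R, +oo[) \int[mu]_(x in `]0%R, u[) (a x * b u)%:E)%E.
Proof.
transitivity (\int[mu]_x \int[mu]_u G (x, u))%E.
  rewrite integral_mkcond; apply: eq_integral => x _; rewrite patchE.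
  case: ifPn; first by rewrite inE/= in_itv/= andbT => x0; rewrite G_section.
  rewrite notin_setE/= in_itv/= andbT => /negP/negbTE x0.
  by apply/esym; rewrite integral0_eq// => u _; rewrite /G/= x0.
rewrite fubini_tonelli//.
apply/esym; rewrite integral_mkcond; apply: eq_integral => u _; rewrite patchE.
case: ifPn => u0.
  rewrite integral_mkcond; apply: eq_integral => x _; rewrite patchE /G/=.
  case: ifPn; first by rewrite inE/= in_itv/= => ->.
  by rewrite notin_setE/= in_itv/= => /negP/negbTE ->.
apply/esym; rewrite integral0_eq// => x _; rewrite /G/=.
case: ifP => // /andP[x0 xu]; move: u0; rewrite notin_setE/= in_itv/= andbT.
by move=> /negP; rewrite (lt_trans x0).
Qed.

End tonelli_triangle.

Section hardy.
Context {R : realType}.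
Notation mu := (@lebesgue_measure R).
Variables (g : R -> R) (p : R).
Hypotheses (mg : measurable_fun [set: measurableTypeR R] g)
  (g0 : forall x, 0 <= g x) (p1 : 1 <= p).

Let mgp : measurable_fun [set: measurableTypeR R] (fun u => g u `^ p * u `^ (- 2^-1)).
Proof.
apply: measurable_funM; last exact: measurable_powR.
exact: (measurableT_comp (measurable_powR p)).
Qed.

(** Equal to 1 for p = 1, because 0 to the power 0 is 1. *)
Definition hardy_const : R := (2 * (p - 1)) `^ (p - 1).

(** For p > 1, split g(u) / u as the product of g(u) u^(-1/(2p)) and
    u^(1/(2p) - 1) and apply the inequality of Hoelder: the second factor has an
    explicit norm on ]x, +oo[.  For p = 1, use u^(-1/2) <= x^(-1/2). *)
Lemma hardy_pointwise x : 0 < x ->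
  ((\int[mu]_(u in `]x, +oo[) (g u * u `^ (- 1))%:E) `^ p <=
   (hardy_const * x `^ (- 2^-1))%:E *
     \int[mu]_(u in `]x, +oo[) (g u `^ p * u `^ (- 2^-1))%:E)%E.
Proof.
move=> x0; have p0 : 0 < p := lt_le_trans ltr01 p1.
have mD : measurable (`]x, +oo[%classic : set (measurableTypeR R)).
  exact: measurable_itv.
have [pE|pN1] := eqVneq p 1.
  rewrite /hardy_const pE subrr powRr0 mul1r poweRe1; last first.
    by apply: integral_ge0 => u _; rewrite lee_fin mulr_ge0 ?powR_ge0.
  rewrite -ge0_integralZl//; last 3 first.
  - by apply/measurable_EFinP; move: mgp; rewrite pE; exact: measurable_funTS.
  - by move=> u _; rewrite lee_fin mulr_ge0 ?powR_ge0.
  - by rewrite lee_fin powR_ge0.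
  apply: ge0_le_integral => //.
  - by move=> u _; rewrite lee_fin mulr_ge0 ?powR_ge0.
  - by apply/measurable_EFinP/measurable_funTS; exact: measurable_funM.
  - apply/measurable_EFinP/measurable_funTS; apply: measurable_funM => //.
    by move: mgp; rewrite pE.
  - move=> u/=; rewrite in_itv/= andbT => xu; have u0 := lt_trans x0 xu.
    rewrite lee_fin powRr1// mulrCA ler_wpM2l//.
    have -> : u `^ (- 1) = u `^ (- 2^-1) * u `^ (- 2^-1).
      by rewrite -powRD ?(gt_eqF u0) ?implybT//; congr (_ `^ _); field.
    rewrite ler_wpM2r ?powR_ge0// !powRN lef_pV2 ?posrE ?powR_gt0//.
    by apply: ge0_ler_powR; rewrite ?nnegrE ?ltW.
have p1' : 0 < p - 1 by rewrite subr_gt0 lt_neqAle eq_sym pN1.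
(* q is the conjugate exponent and t = 1/(2p) the exponent of the weight; then
   (1 - t) q = 1 + e, so the second factor is integrable at infinity. *)
pose q := p / (p - 1); pose t := (2 * p)^-1; pose e := (2 * (p - 1))^-1.
have q0 : 0 < q by rewrite divr_gt0.
have e0 : 0 < e by rewrite invr_gt0 mulr_gt0.
have pq : p^-1 + q^-1 = 1 by rewrite /q; field; rewrite !gt_eqF.
pose D := `]x, +oo[%classic : set (measurableTypeR R).
pose f1 u : R := g u * u `^ (- t) * \1_D u.
pose f2 u : R := u `^ (t - 1) * \1_D u.
have mI : measurable_fun [set: measurableTypeR R] (\1_D : _ -> R).
  exact: measurable_indic.
have mf1 : measurable_fun [set: measurableTypeR R] f1.
  by apply: measurable_funM => //; exact: measurable_funM.
have mf2 : measurable_fun [set: measurableTypeR R] f2.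
  exact: measurable_funM.
have ID (F h : R -> R) : (forall u, x < u -> F u = h u) -> (forall u, u <= x -> F u = 0) ->
    (\int[mu]_u (F u)%:E = \int[mu]_(u in `]x, +oo[) (h u)%:E)%E.
  move=> Fh F0; rewrite [RHS]integral_mkcond; apply: eq_integral => u _.
  rewrite patchE; case: ifPn; rewrite ?inE ?notin_setE/= in_itv/= andbT.
    by move=> xu; rewrite Fh.
  by move=> /negP; rewrite -leNgt => ux; rewrite F0.
have fD u : x < u -> \1_D u = 1 :> R.
  by move=> xu; rewrite indicE mem_set// /D/= in_itv/= xu.
have fN u : u <= x -> \1_D u = 0 :> R.
  by move=> ux; rewrite indicE memNset// /D/= in_itv/= andbT; apply/negP; rewrite -leNgt.
have := @hoelder _ _ R mu f1 f2 p q mf1 mf2 p0 q0 pq.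
rewrite Lnorm1 (_ : (\int[mu]_u _ = \int[mu]_(u in `]x, +oo[) (g u * u `^ (- 1))%:E)%E); last first.
  apply: (ID (fun u => `|f1 u * f2 u|)) => [u xu|u ux]; last first.
    by rewrite /f1 fN// mulr0 mul0r normr0.
  rewrite /f1 /f2 fD// !mulr1 ger0_norm ?mulr_ge0 ?powR_ge0// -mulrA; congr (_ * _).
  have u0 := lt_trans x0 xu.
  by rewrite -powRD ?(gt_eqF u0) ?implybT//; congr (_ `^ _); ring.
move=> H; have := gt0_ler_poweR (ltW p0) _ _ H.
rewrite !in_itv/= !leey !andbT mule_ge0 ?Lnorm_ge0// integral_ge0; last first.
  by move=> u _; rewrite lee_fin mulr_ge0 ?powR_ge0.
move=> /(_ isT isT) /le_trans; apply.
rewrite poweRM ?Lnorm_ge0// muleC.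
rewrite powR_Lnorm ?gt_eqF//.
rewrite (_ : (\int[mu]_u _ = \int[mu]_(u in `]x, +oo[) (g u `^ p * u `^ (- 2^-1))%:E)%E); last first.
  apply: (ID (fun u => `|f1 u| `^ p)) => [u xu|u ux]; last first.
    by rewrite /f1 fN// mulr0 normr0 powR0// gt_eqF.
  rewrite /f1 fD// !mulr1 ger0_norm ?mulr_ge0 ?powR_ge0// powRM ?powR_ge0//.
  congr (_ * _); rewrite -powRrM; congr (_ `^ _); rewrite /t; field.
  by rewrite gt_eqF.
apply: lee_wpmul2r.
  by apply: integral_ge0 => u _; rewrite lee_fin mulr_ge0 ?powR_ge0.
(* N_q^p = (N_q^q)^(p - 1). *)
have pqE : p = q * (p - 1) by rewrite /q mulrAC mulrK// unitfE gt_eqF.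
rewrite [X in (_ `^ X)%E]pqE poweRrM powR_Lnorm ?gt_eqF//.
rewrite (_ : (\int[mu]_u _ = \int[mu]_(u in `]x, +oo[) (u `^ (- e - 1))%:E)%E); last first.
  apply: (ID (fun u => `|f2 u| `^ q)) => [u xu|u ux]; last first.
    by rewrite /f2 fN// mulr0 normr0 powR0// gt_eqF.
  rewrite /f2 fD// !mulr1 ger0_norm ?powR_ge0// -powRrM; congr (_ `^ _).
  by rewrite /t /q /e; field; rewrite !gt_eqF.
have := integral_powR_tail_le e0 x0.
move=> /(gt0_ler_poweR (ltW p1')).
have ei0 : 0 <= e^-1 by rewrite invr_ge0 ltW.
rewrite !in_itv/= !leey !andbT lee_fin (mulr_ge0 (powR_ge0 _ _) ei0).
rewrite integral_ge0; last by move=> u _; rewrite lee_fin powR_ge0.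
move=> /(_ isT isT) /le_trans; apply.
rewrite lee_fin powRM ?powR_ge0//.
rewrite -powRrM mulrC /hardy_const /e invrK le_eqVlt; apply/orP; left; apply/eqP.
by congr (_ * _ `^ _); field; rewrite gt_eqF.
Qed.

(** The weights of the pointwise bound are chosen so that, after exchanging the
    integrals, the inner integral of x^(-1/2) over ]0, u[ cancels u^(-1/2). *)
Lemma hardy :
  (\int[mu]_(x in `]0%R, +oo[) (\int[mu]_(u in `]x, +oo[) (g u / u)%:E) `^ p <=
   (hardy_const * 2)%:E * \int[mu]_(u in `]0%R, +oo[) (g u `^ p)%:E)%E.
Proof.
have mD x : measurable (`]x, +oo[%classic : set (measurableTypeR R)).
  exact: measurable_itv.
have h0 : 0 <= hardy_const by exact: powR_ge0.
pose b u := g u `^ p * u `^ (- 2^-1).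
have b0 u : 0 <= b u by rewrite mulr_ge0 ?powR_ge0.
have mb : measurable_fun [set: measurableTypeR R] b by exact: mgp.
pose a x : R := hardy_const * x `^ (- 2^-1).
have a0 u : 0 <= a u by rewrite mulr_ge0 ?powR_ge0.
have ma : measurable_fun [set: measurableTypeR R] a.
  exact: measurable_funM.
have mw : measurable_fun [set: measurableTypeR R] (fun u => g u * u `^ (- 1)).
  exact: measurable_funM.
have w0 u : 0 <= g u * u `^ (- 1) by rewrite mulr_ge0 ?powR_ge0.
have abE x : 0 < x -> (\int[mu]_(u in `]x, +oo[) (a x * b u)%:E =
    (a x)%:E * \int[mu]_(u in `]x, +oo[) (b u)%:E)%E.
  move=> x0; under eq_integral do rewrite EFinM.
  rewrite ge0_integralZl//; first exact/measurable_EFinP/measurable_funTS.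
    by move=> u _; rewrite lee_fin.
  by rewrite lee_fin.
apply: (@le_trans _ _ (\int[mu]_(x in `]0%R, +oo[) \int[mu]_(u in `]x, +oo[) (a x * b u)%:E)%E).
  rewrite [leLHS](_ : _ = \int[mu]_(x in `]0%R, +oo[)
      (\int[mu]_(u in `]x, +oo[) (g u * u `^ (- 1))%:E) `^ p)%E; last first.
    apply: eq_integral => x; rewrite inE/= in_itv/= andbT => x0; congr (_ `^ _)%E.
    apply: eq_integral => u; rewrite inE/= in_itv/= andbT => xu.
    by rewrite powR_inv1// ltW// (lt_trans x0).
  apply: ge0_le_integral => //.
  - by move=> x _; exact: poweR_ge0.
  - apply: (measurableT_comp (measurable_poweR p)).
    have := measurable_tail_integral (@measurable_cst _ _ (measurableTypeR R) _ setT (1 : R)) mw (fun=> ler01) w0.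
    by under [X in measurable_fun _ X -> _]eq_fun do
      under eq_integral do rewrite mul1r.
  - exact: measurable_tail_integral.
  - move=> x/=; rewrite in_itv/= andbT => x0; rewrite abE//.
    exact: hardy_pointwise.
rewrite tonelli_triangle//.
rewrite -ge0_integralZl//; last 3 first.
- apply/measurable_EFinP/measurable_funTS.
  exact: (measurableT_comp (measurable_powR p)).
- by move=> u _; rewrite lee_fin powR_ge0.
- by rewrite lee_fin mulr_ge0.
rewrite le_eqVlt; apply/orP; left; apply/eqP; apply: eq_integral => u.
rewrite inE/= in_itv/= andbT => u0.
rewrite (_ : (\int[mu]_(x in _) _)%E = (\int[mu]_(x in `]0%R, u[)
    ((hardy_const * b u)%:E * (x `^ (2^-1 - 1))%:E))%E); last first.
  apply: eq_integral => x _.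
  by rewrite -EFinM mulrAC (_ : 2^-1 - 1 = - 2^-1 :> R)//; field.
rewrite ge0_integralZl//; last 3 first.
- apply/measurable_EFinP/measurable_funTS; exact: measurable_powR.
- by move=> x _; rewrite lee_fin powR_ge0.
- by rewrite lee_fin mulr_ge0.
rewrite integral_powR_head// -!EFinM; congr (_%:E).
have E : u `^ (- 2^-1) * u `^ (2^-1) = 1.
  by rewrite -powRD ?(gt_eqF u0) ?implybT// addNr powRr0.
transitivity (hardy_const * 2 * g u `^ p * (u `^ (- 2^-1) * u `^ (2^-1))).
  by rewrite /b invrK; ring.
by rewrite E mulr1.
Qed.

End hardy.

(** * Measures with a density *)

Section density.
Context {R : realType} (nu : probability (measurableTypeR R) R) (D : set R) (p : R -> R).
Notation mu := (@lebesgue_measure R).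
Hypotheses (mD : measurable (D : set (measurableTypeR R))) (nup : density_on D nu p).

(** The sign of p is not prescribed, so finiteness of nu is used separately on
    the sets where p is nonnegative and where it is negative. *)
Lemma density_integrable : mu.-integrable D (EFin \o p).
Proof.
have [mp nuE] := nup.
pose P := D `&` [set x | 0 <= p x]; pose N := D `&` [set x | p x < 0].
have mP : measurable (P : set (measurableTypeR R)).
  rewrite /P (_ : [set x | 0 <= p x] = p @^-1` `[0, +oo[); first exact: mp.
  by apply/seteqP; split => x /=; rewrite in_itv/= andbT.
have mN : measurable (N : set (measurableTypeR R)).
  rewrite /N (_ : [set x | p x < 0] = p @^-1` `]-oo, 0[); first exact: mp.
  by apply/seteqP; split => x /=; rewrite in_itv/=.
have DE : D = P `|` N.
  apply/seteqP; split => [x Dx|x [[]//|[]//]].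
  by case: (leP 0 (p x)) => ?; [left|right].
have mpE A : A `<=` D -> measurable (A : set (measurableTypeR R)) -> measurable_fun A (EFin \o p).
  by move=> AD mA; apply/measurable_EFinP; exact: measurable_funS mp.
apply/integrableP; split; first exact: mpE.
have mabs : measurable_fun D (fun x => `|(EFin \o p) x|%E).
  by apply: measurableT_comp => //; exact: mpE.
rewrite DE ge0_integral_setU//; last 2 first.
- by rewrite -DE.
- by apply/disj_setPS => x [[_ /= ?] [_ /=]]; rewrite ltNge => /negP.
have ltP A : measurable (A : set (measurableTypeR R)) -> (nu A < +oo)%E.
  by move=> mA; rewrite -ge0_fin_numE// fin_num_measure.
apply: lte_add_pinfty.
  rewrite (_ : (\int[mu]_(x in P) _ = nu P)%E) ?ltP//.
  rewrite nuE//; last by move=> x [].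
  by apply: eq_integral => x; rewrite inE => -[_ /= px]; rewrite ger0_norm.
have -> : (\int[mu]_(x in N) `|(EFin \o p) x| = - nu N)%E.
  rewrite nuE//; last by move=> x [].
  rewrite -[LHS]oppeK -integral_ge0N; last by move=> x _; exact: abse_ge0.
  congr (- _)%E; apply: eq_integral => x; rewrite inE => -[_ /= px].
  by rewrite ltr0_norm// opprK.
by rewrite lteNl/= (lt_le_trans _ (measure_ge0 _ _)).
Qed.

Lemma density_small e : 0 < e -> exists2 d : R, 0 < d &
  forall A : set (measurableTypeR R), measurable A -> A `<=` D -> (mu A < d%:E)%E ->
    fine (nu A) < e.
Proof.
move=> e0; have intp := density_integrable.
have : mu.-integrable setT (EFin \o p \_ D).
  by rewrite -restrict_EFin; apply/integrable_restrict => //=; rewrite setTI.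
move=> /integral_normr_continuous /(_ _ e0)[d [d0 dA]].
exists d => // A mA AD Ad; apply: le_lt_trans (dA A mA Ad).
have [_ nuE] := nup; rewrite (nuE A)//.
apply: (@le_trans _ _ (`|\int[mu]_(x in A) p x|)); first exact: ler_norm.
have intA : mu.-integrable A (EFin \o p) by exact: integrableS intp.
apply: (le_trans (le_normr_Rintegral _ intA)) => //.
rewrite le_eqVlt; apply/orP; left; apply/eqP; apply: eq_Rintegral => x xA.
by rewrite patchE ifT// inE; apply: AD; rewrite -inE.
Qed.

Lemma density_null (A : set R) : measurable (A : set (measurableTypeR R)) ->
  A `<=` D -> mu A = 0%E -> nu A = 0%E.
Proof.
move=> mA AD A0; have [mp nuE] := nup; rewrite (nuE A)//.
by apply: null_set_integral => //; apply/measurable_EFinP; exact: measurable_funS mp.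
Qed.

End density.

Section density_change_of_variables.
Context {R : realType} (nu : probability (measurableTypeR R) R) (g : R -> R).
Notation mu := (@lebesgue_measure R).
Hypotheses (nu0 : nu `]-oo, 0[%classic = 0%E) (nug : density_on `[0, +oo[ nu g).

Let mitv (i : interval R) : measurable ([set` i] : set (measurableTypeR R)).
Proof. exact: measurable_itv. Qed.

Let nu_dom : nu `<< mu.
Proof.
apply/null_content_dominatesP => A mA A0.
have mAp : measurable (A `&` `[0, +oo[ : set (measurableTypeR R)) by exact: measurableI.
have mAn : measurable (A `&` `]-oo, 0[ : set (measurableTypeR R)) by exact: measurableI.
rewrite (_ : A = (A `&` `]-oo, 0[) `|` (A `&` `[0, +oo[)); last first.
  by rewrite -setIUr -itv_bndbnd_setU ?bnd_simp// set_itvNyy setIT.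
apply: null_set_setU => //.
- by apply: (subset_measure0 mAn (mitv _) _ nu0) => x [].
- apply: (density_null (mitv _) nug) => //.
  by apply: (@subset_measure0 _ _ _ mu _ _ mAp mA) => //; move=> x [].
Qed.

(** The function g agrees almost everywhere on ]x, +oo[ with the Radon-Nikodym
    derivative, for which the change of variables is known. *)
Lemma integral_density (x : R) (f : R -> R) : 0 <= x ->
  nu.-integrable `]x, +oo[ (EFin \o f) ->
  (\int[nu]_(u in `]x, +oo[) (f u)%:E = \int[mu]_(u in `]x, +oo[) (f u * g u)%:E)%E.
Proof.
move=> x0 intf.
rewrite -(Radon_Nikodym_change_of_variables nu_dom)//=.
have sub : `]x, +oo[ `<=` `[0, +oo[.
  by move=> u /=; rewrite !in_itv/= !andbT => /ltW; exact: le_trans.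
have [mg nuE] := nug.
have mgx : measurable_fun (`]x, +oo[%classic : set (measurableTypeR R)) (EFin \o g).
  by apply/measurable_EFinP; exact: measurable_funS mg.
under [RHS]eq_integral do rewrite EFinM.
apply: ae_eq_integral => //.
- apply: emeasurable_funM => //; first exact: measurable_int intf.
  apply: (measurable_int mu).
  apply: (integrableS _ _ (@subsetT _ _)) => //=.
  by apply: Radon_Nikodym_integrable; exact: nu_dom.
- by apply: emeasurable_funM => //; exact: measurable_int intf.
- apply: ae_eqe_mul2l => /=.
  rewrite Radon_NikodymE/=; case: cid => /= h [h1 h2 h3].
  apply: integral_ae_eq => //=.
  + exact: integrableS h2.
  + move=> E E01 mE; rewrite -h3//= nuE//.
    exact: subset_trans sub.
Qed.

End density_change_of_variables.

Section distribution_function.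
Context {R : realType} (P : probability (measurableTypeR R) R) (p : R -> R).
Notation mu := (@lebesgue_measure R).
Hypothesis Pp : density_on `]0%R, +oo[ P p.
Notation F := (distribution_function P).

Let mitv (i : interval R) : measurable ([set` i] : set (measurableTypeR R)).
Proof. exact: measurable_itv. Qed.

Lemma distribution_function_increment (s t : R) : 0 <= s -> s <= t ->
  F t - F s = fine (P `]s, t]%classic).
Proof.
move=> s0 st; rewrite /distribution_function.
have -> : `[0, t]%classic = `[0, s]%classic `|` `]s, t]%classic :> set (measurableTypeR R).
  by rewrite -itv_bndbnd_setU// bnd_simp.
rewrite measureU//.
  by rewrite fineD ?fin_num_measure// addrC addKr.
apply/seteqP; split => // x [/=]; rewrite !in_itv/= => /andP[_ xs] /andP[sx _].
by have := lt_le_trans sx xs; rewrite ltxx.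
Qed.

(** The union of the intervals has small Lebesgue measure, hence small mass.
    Open and half-open intervals have the same mass because points of the open
    half-line are null. *)
Lemma distribution_function_absolutely_continuous (a : R) :
  absolutely_continuous 0 a F.
Proof.
move=> e e0; have [d d0 dP] := density_small (mitv _) Pp e0.
exists d => // n s t st tI sum_d.
have PE i : `|F (t i) - F (s i)| = fine (P `]s i, t i[%classic).
  have [s0 sit ta] := st i.
  rewrite distribution_function_increment// ger0_norm ?fine_ge0//.
  have [tis|sti] := leP (t i) (s i).
    by rewrite !set_itv_ge//= ?bnd_simp -?leNgt// -leNgt.
  rewrite -(@setUitv1 _ _ _ _ true)//= measureU//; last first.
    apply/seteqP; split => // x [/=]; rewrite in_itv/= => /andP[_ +] xt.
    by rewrite xt ltxx.
  rewrite [X in (_ + X)%E](_ : _ = 0%E) ?adde0//.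
  apply: (density_null (mitv _) Pp) => //; last exact: lebesgue_measure_set1.
  by move=> x /= ->; rewrite in_itv/= andbT (le_lt_trans s0).
under eq_bigr do rewrite PE.
pose U := \big[setU/set0]_(i < n) (`]s i, t i[%classic : set (measurableTypeR R)).
have mU : measurable U by apply: bigsetU_measurable => i _; exact: mitv.
have PU : P U = (\sum_(i < n) P `]s i, t i[%classic)%E by apply: measure_semi_additive_ord.
have muU : mu U = (\sum_(i < n) mu `]s i, t i[%classic)%E by apply: measure_semi_additive_ord.
have -> : \sum_(i < n) fine (P `]s i, t i[%classic) = fine (P U).
  by rewrite PU sum_fine// => i _; rewrite fin_num_measure.
apply: dP => //.
  rewrite /U; elim/big_ind : _ => //; first by move=> ? ? ? ?; rewrite subUset.
  move=> i _ x /=; rewrite !in_itv/= andbT => /andP[sx _].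
  by have [s0 _ _] := st i; exact: le_lt_trans sx.
rewrite muU; apply: (@le_lt_trans _ _ (\sum_(i < n) (t i - s i))%:E).
  rewrite -sumEFin; apply: lee_sum => i _; have [s0 sit ta] := st i.
  rewrite lebesgue_measure_itv/= lte_fin; case: ifP => _.
    by rewrite -EFinD.
  by rewrite lee_fin subr_ge0.
by rewrite lte_fin.
Qed.

Lemma is_derive_distribution_function (x : R) : 0 < x -> {for x, continuous p} ->
  is_derive x 1 F (p x).
Proof.
move=> x0 px; have xx1 : x < x + 1 by rewrite ltrDl.
have intp : mu.-integrable [set` Interval (BRight 0) (BRight (x + 1))] (EFin \o p).
  apply: (integrableS _ _ _ (density_integrable (mitv _) Pp)) => //=.
  exact: subset_itvl.
have [|dG GE] := continuous_FTC1 xx1 intp _ px; first exact: x0.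
apply: (@near_eq_is_derive R R R (fun y => F 0 + \int[mu]_(t in `]0, y]) p t)).
  near=> y; have y0 : 0 < y by near: y; exact: lt_nbhsr.
  rewrite -[RHS](subrK (F 0)) addrC; congr (_ + _).
  rewrite (distribution_function_increment (lexx 0) (ltW y0)).
  by have [_ ->] := Pp => //; exact: subset_itvl.
have dG' : is_derive x 1 (fun y => \int[mu]_(t in `]0, y]) p t) (p x).
  by apply: DeriveDef => //; rewrite -derive1E.
have := is_deriveD (is_derive_cst (F 0) x 1) dG'.
by rewrite add0r.
Unshelve. all: by end_near. Qed.

End distribution_function.

(** * Membership in the Lebesgue spaces of the half-line *)

Section lebesgue_spaces.
Context {R : realType}.
Notation mu := (@lebesgue_measure R).
Implicit Types (h : R -> R).

Let mpos : measurable (`]0, +oo[%classic : set (measurableTypeR R)).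
Proof. exact: measurable_itv. Qed.

Lemma Lp_pos_dominated (p C : R) h (H : R -> \bar R) : 1 <= p -> 0 <= C ->
  measurable_fun (`]0, +oo[%classic : set (measurableTypeR R)) h ->
  measurable_fun (`]0, +oo[%classic : set (measurableTypeR R)) H ->
  (forall x, 0 < x -> (`|h x|%:E <= C%:E * H x)%E) ->
  (forall x, 0 < x -> (0 <= H x)%E) ->
  (\int[mu]_(x in `]0%R, +oo[) (H x) `^ p < +oo)%E ->
  Lp_pos p%:E h.
Proof.
move=> p1 C0 mh mH hH H0 Hoo; have p0 : 0 < p := lt_le_trans ltr01 p1.
apply/andP; split; rewrite inE/=.
  by apply/(measurable_restrictT _ _).1.
rewrite /finite_norm unlock /Lnorm; apply: poweR_lty.
rewrite (_ : (\int[mu]_x _ = \int[mu]_(x in `]0%R, +oo[) (`|h x| `^ p)%:E)%E); last first.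
  rewrite [RHS]integral_mkcond; apply: eq_integral => x _.
  by rewrite /= !patchE; case: ifPn => // _; rewrite normr0 powR0// gt_eqF.
apply: (@le_lt_trans _ _ (\int[mu]_(x in `]0%R, +oo[) ((C `^ p)%:E * (H x) `^ p))%E).
  apply: ge0_le_integral => //.
  - apply/measurable_EFinP; apply: (measurableT_comp (measurable_powR p)).
    exact: measurableT_comp.
  - apply: emeasurable_funM => //.
    exact: (measurableT_comp (measurable_poweR p)).
  - move=> x/=; rewrite in_itv/= andbT => x0.
    rewrite -poweR_EFin -[leRHS](_ : ((C%:E * H x) `^ p)%E = _); last first.
      by rewrite poweRM ?H0// poweR_EFin.
    rewrite -[leLHS]/((`|h x|%:E `^ p)%E).
    apply: gt0_ler_poweR; rewrite ?(ltW p0) ?in_itv/= ?leey ?andbT ?mule_ge0 ?lee_fin ?H0//.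
    exact: hH.
rewrite ge0_integralZl//; last 3 first.
- exact: (measurableT_comp (measurable_poweR p)).
- by move=> x _; exact: poweR_ge0.
- by rewrite lee_fin powR_ge0.
by rewrite lte_mul_pinfty// lee_fin powR_ge0.
Qed.

Lemma Linfty_pos_bounded h (M : R) (N : set R) : 0 <= M -> countable N ->
  measurable_fun (`]0, +oo[%classic : set (measurableTypeR R)) h ->
  (forall x, 0 < x -> ~ N x -> `|h x| <= M) -> Lp_pos +oo%E h.
Proof.
move=> M0 cN mh hM; apply/andP; split; rewrite inE/=.
  by apply/(measurable_restrictT _ _).1.
rewrite /finite_norm unlock /Lnorm; case: ifP => _; last by rewrite ltry.
apply: (@le_lt_trans _ _ M%:E); last exact: ltry.
apply/ess_supP.
exists N; split.
- exact: countable_measurable.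
- exact: countable_lebesgue_measure0.
move=> x /= hx; apply: contrapT => Nx; apply: hx.
rewrite lee_fin patchE; case: ifPn; last by rewrite normr0.
by rewrite inE/= in_itv/= andbT => x0; exact: hM.
Qed.

(** Needed for the derivative of order J, whose values at the atoms are not given
    by the formula in terms of tail moments. *)
Lemma measurable_fun_countable_modification (D N : set R) (f g : R -> R) :
  countable N -> (forall x, D x -> ~ N x -> f x = g x) ->
  measurable_fun (D : set (measurableTypeR R)) g ->
  measurable_fun (D : set (measurableTypeR R)) f.
Proof.
move=> cN fg mg mD B mB.
have mN A : measurable (N `&` A : set (measurableTypeR R)).
  apply: countable_measurable => //; apply: (sub_countable _ cN).
  by apply: subset_card_le => x [].
rewrite (_ : _ `&` _ = ((D `&` g @^-1` B) `\` N) `|` (N `&` (D `&` f @^-1` B))).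
  apply: measurableU; last exact: mN.
  apply: measurableD; first exact: mg.
  by rewrite -(setIT N); exact: mN.
apply/seteqP; split => x /=.
  move=> [Dx fx]; have [Nx|Nx] := pselect (N x); first by right.
  by left; split => //; split => //; rewrite -fg.
by move=> [[[Dx gx] Nx]|[Nx []//]]; split => //; rewrite fg.
Qed.

Lemma atoms_countable (nu : probability (measurableTypeR R) R) :
  countable [set x : R | nu [set x] <> 0%E].
Proof.
have midf : (idfun : measurableTypeR R -> R) \in mfun.
  by rewrite inE; exact: measurable_id.
have := @pmf_gt0_countable _ _ R nu (mfun_Sub midf).
apply: sub_countable; apply: subset_card_le => x /= nux.
rewrite /pmf /= preimage_id fine_gt0// lt0e measure_ge0 andbT.
by rewrite -ge0_fin_numE// fin_num_measure// andbT; apply/eqP.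
Qed.

End lebesgue_spaces.

(** * A value of the Beta function *)

Section gamma.
Context {R : realType}.
Notation mu := (@lebesgue_measure R).

(** With values in the extended reals, where integrals of nonnegative functions
    can be exchanged freely. *)
Let eGamma (a : R) : \bar R :=
  (\int[mu]_(t in `]0%R, +oo[) (t `^ (a - 1) * expR (- t))%:E)%E.

Let mexpN : measurable_fun [set: measurableTypeR R] (fun t : R => expR (- t)).
Proof. by apply: measurableT_comp => //; exact: measurable_funN. Qed.

Lemma integral_expRN_tail (x : R) :
  (\int[mu]_(t in `]x, +oo[) (expR (- t))%:E = (expR (- x))%:E)%E.
Proof.
rewrite integral_itv_obnd_cbnd; last exact/measurable_EFinP/measurable_funTS.
have dN (t : R) : is_derive t 1 (fun u : R => - expR (- u)) (expR (- t)).
  have dh := is_deriveN (is_derive1_comp (is_derive_expR (- t)) (is_deriveNid t 1)).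
  by apply: (is_derive_eq dh); rewrite mulrN1 opprK.
have cE : continuous (fun u : R => expR (- u)).
  move=> u; apply: continuous_comp; [exact: opp_continuous|exact: continuous_expR].
rewrite (@ge0_continuous_FTC2y _ _ (fun u => - expR (- u)) x 0).
- by rewrite sub0e -EFinN opprK.
- by move=> u _; exact: expR_ge0.
- exact: continuous_subspaceT.
- rewrite -oppr0; apply: cvgN; exact: cvgr_expR.
- by move=> u _; apply: ex_derive; exact: dN.
- by apply: cvg_at_right_filter; apply: cvgN; exact: cE.
- by move=> u _; rewrite derive1E; apply: derive_val; exact: dN.
Qed.

(** Write expR (- x) as its integral over ]x, +oo[ and exchange the integrals;
    no boundary term at 0 appears, unlike in an integration by parts. *)
Let eGammaD1 (a : R) : 0 < a -> eGamma a = ((a^-1)%:E * eGamma (a + 1))%E.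
Proof.
move=> a0; have ma : measurable_fun [set: measurableTypeR R] (fun x : R => x `^ (a - 1)).
  exact: measurable_powR.
have eg0 (x : R) : 0 <= expR (- x) by exact: expR_ge0.
have pg0 (x : R) : 0 <= x `^ (a - 1) by exact: powR_ge0.
have := tonelli_triangle ma mexpN pg0 eg0.
rewrite (_ : (\int[mu]_(x in `]0%R, +oo[) _ = eGamma a)%E) => [->|]; last first.
  apply: eq_integral => x _; under eq_integral do rewrite EFinM.
  rewrite ge0_integralZl//; last 2 first.
  - exact/measurable_EFinP/measurable_funTS.
  - by rewrite lee_fin.
  by rewrite integral_expRN_tail -EFinM.
rewrite /eGamma -ge0_integralZl//; last 3 first.
- apply/measurable_EFinP/measurable_funTS; apply: measurable_funM => //.
- by move=> u _; rewrite lee_fin mulr_ge0 ?powR_ge0.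
- by rewrite lee_fin invr_ge0 ltW.
apply: eq_integral => u; rewrite inE/= in_itv/= andbT => u0.
under eq_integral do rewrite mulrC EFinM.
rewrite ge0_integralZl//; last 2 first.
- exact/measurable_EFinP/measurable_funTS.
- by move=> x _; rewrite lee_fin.
rewrite integral_powR_head// -!EFinM addrK; congr (_%:E).
by rewrite mulrA mulrC (mulrC (expR _)).
Qed.

Let eGamma1 : eGamma 1 = 1%E.
Proof.
rewrite /eGamma subrr -[RHS](_ : (expR (- 0))%:E = _); last first.
  by rewrite oppr0 expR0.
rewrite -integral_expRN_tail; apply: eq_integral => t _.
by rewrite powRr0 mul1r.
Qed.

Let eGamma2 : eGamma (1 + 1) = 1%E.
Proof.
by have := eGammaD1 (@ltr01 R); rewrite invr1 mul1e eGamma1.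
Qed.

(** The square root of u is at most 1 + u. *)
Let eGamma32_lty : (eGamma (2^-1 + 1) < +oo)%E.
Proof.
apply: (@le_lt_trans _ _ (eGamma 1 + eGamma (1 + 1))%E); last first.
  by rewrite eGamma1 eGamma2 ltry.
rewrite /eGamma -ge0_integralD//; last 4 first.
- by move=> u _; rewrite lee_fin mulr_ge0 ?powR_ge0 ?expR_ge0.
- by apply/measurable_EFinP/measurable_funTS; exact: measurable_funM.
- by move=> u _; rewrite lee_fin mulr_ge0 ?powR_ge0 ?expR_ge0.
- by apply/measurable_EFinP/measurable_funTS; exact: measurable_funM.
apply: ge0_le_integral => //.
- by move=> u _; rewrite lee_fin mulr_ge0 ?powR_ge0 ?expR_ge0.
- by apply/measurable_EFinP/measurable_funTS; exact: measurable_funM.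
- apply: emeasurable_funD;
    by apply/measurable_EFinP/measurable_funTS; exact: measurable_funM.
move=> u/=; rewrite in_itv/= andbT => u0.
rewrite -EFinD lee_fin -mulrDl ler_wpM2r ?expR_ge0//.
rewrite !addrK subrr powRr0 (powRr1 (ltW u0)).
have [u1|u1] := leP 1 u.
  apply: (@le_trans _ _ u); last by rewrite lerDr.
  by apply: ler1_powR => //; lra.
apply: (@le_trans _ _ 1); last by rewrite lerDl ltW.
by rewrite -[leRHS](powRr0 u); apply: ger_powR; rewrite ?u0 ?invr_ge0// ltW.
Qed.

Let eGamma32_gt0 : (0 < eGamma (2^-1 + 1))%E.
Proof.
have h : (0 < (expR (- 1) : R)%:E)%E by rewrite lte_fin expR_gt0.
apply: (lt_le_trans h); rewrite -integral_expRN_tail.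
apply: (@le_trans _ _ (\int[mu]_(t in `]1%R, +oo[) (t `^ (2^-1 + 1 - 1) * expR (- t))%:E)%E).
  apply: ge0_le_integral => //.
  - by apply/measurable_EFinP; exact: measurable_funTS.
  - by apply/measurable_EFinP/measurable_funTS; exact: measurable_funM.
  - move=> u/=; rewrite in_itv/= andbT => u1.
    rewrite lee_fin ler_peMl ?expR_ge0// addrK.
    by rewrite -[leLHS](powRr0 u) ler_powR// ltW.
apply: ge0_subset_integral => //.
- by apply/measurable_EFinP/measurable_funTS; exact: measurable_funM.
- by move=> u _; rewrite lee_fin mulr_ge0 ?powR_ge0 ?expR_ge0.
- by apply: subset_itvr; rewrite bnd_simp.
Qed.

Lemma Beta_half_1 : Beta (1 / 2) 1 = 2 :> R.
Proof.
have GE a : Gamma a = fine (eGamma a) by [].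
rewrite /Beta !GE mul1r eGamma1/= mulr1 eGammaD1 ?invr_gt0// invrK.
have fin : eGamma (2^-1 + 1) \is a fin_num by rewrite gt0_fin_numE.
rewrite fineM//= mulfK// gt_eqF// fine_gt0// eGamma32_gt0.
exact: eGamma32_lty.
Qed.

End gamma.

(** * Regularity of the Schoenberg measure *)

Section regularity.
Context {R : realType} (m J : nat) (nu_m nu : probability (measurableTypeR R) R).
Notation p := (schoenberg_density m J.+1 nu).
Notation F := (distribution_function nu_m).
Let c : R := 2 / Beta (m%:R / 2) J.+1%:R.

Lemma schoenberg_densityE_pos x : 0 < x -> p x = c * scaled_moment nu m J 0 x.
Proof. by move=> x0; rewrite schoenberg_densityE// ltW. Qed.

Lemma lipschitz_on_derive1n k (a b : R) : (k < J)%N -> 0 < a ->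
  lipschitz_on a b (derive1n k p).
Proof.
move=> kJ a0; apply: eq_lipschitz_on (lipschitz_on_euler_sum nu m c b kJ a0) => x ax _.
rewrite (derive1n_euler_sum schoenberg_densityE_pos (ltnW kJ) (lt_le_trans a0 ax))//.
by move=> kE; move: kJ; rewrite kE ltnn.
Qed.

Lemma continuous_derive1n k (x : R) : (k < J)%N -> 0 < x ->
  {for x, continuous (derive1n k p)}.
Proof.
move=> kJ x0; have x20 : 0 < x / 2 by rewrite divr_gt0.
apply: (lipschitz_on_continuous (lipschitz_on_derive1n (x + 1) kJ x20)).
  by rewrite ltr_pdivrMr// ltr_pMr// ltr1n.
by rewrite ltrDl.
Qed.

Hypothesis nu_mp : density_on `]0%R, +oo[ nu_m p.

Lemma derive1nS_distribution_function k (x : R) : (k < J)%N -> 0 < x ->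
  derive1n k.+1 F x = derive1n k p x.
Proof.
move=> kJ x0; rewrite derive1Sn.
apply: derive1n_ext_pos; last by rewrite in_itv/= andbT.
move=> y; rewrite in_itv/= andbT => y0; rewrite derive1E.
apply: derive_val; apply: (is_derive_distribution_function nu_mp) => //.
by apply: (@continuous_derive1n 0) => //; exact: leq_ltn_trans kJ.
Qed.

Lemma ACk_loc_distribution_function : ACk_loc J.+1 F.
Proof.
have ac a : absolutely_continuous 0 a F.
  exact: (distribution_function_absolutely_continuous nu_mp).
have ext (h g : R -> R) a b : (forall x, a <= x -> h x = g x) ->
    absolutely_continuous a b g -> absolutely_continuous a b h.
  move=> hg acg e e0; have [d d0 gd] := acg e e0; exists d => // n s t st tI std.
  apply: le_lt_trans (gd n s t st tI std); rewrite le_eqVlt; apply/orP; left.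
  apply/eqP; apply: eq_bigr => i _; have [ai ti bi] := st i.
  by rewrite !hg// (le_trans ai).
split=> [a _|/=|a b a0 ab /=]; first exact: ac.
- split=> [[|i] x iJ x0|x x0].
  + apply: ex_derive; apply: (is_derive_distribution_function nu_mp) => //.
    exact: (@continuous_derive1n 0).
  + apply: (@near_eq_derivable R R R (derive1n i p)); last first.
      apply: (derivable_derive1n schoenberg_densityE_pos) => //; first exact: ltnW.
      by move=> iE; move: iJ; rewrite iE ltnn.
    near=> y; rewrite derive1nS_distribution_function//; first exact: ltnW.
    by near: y; exact: near_pos.
  + case: J (@derive1nS_distribution_function) (@continuous_derive1n) => [|J'] dF cp.
      apply: (absolutely_continuous_continuous (ac (x + 1))) => //.
      by rewrite ltrDl.
    have dE : \near x, derive1n J' (schoenberg_density m J'.+2 nu) x = derive1n J'.+1 F x.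
      by near=> y; rewrite dF//; near: y; exact: near_pos.
    rewrite /prop_for /continuous_at dF//.
    by apply: cvg_trans (cp J' x _ _) => //; exact: near_eq_cvg.
- case: J (@derive1nS_distribution_function) (@lipschitz_on_derive1n) => [|J'] dF lp.
    move=> e e0; have [d d0 dP] := ac b e e0; exists d => // n s t st.
    apply: dP => i; have [ai ti bi] := st i; split => //.
    exact: le_trans (ltW a0) ai.
  apply: ext (lipschitz_on_absolutely_continuous (lp J' a b _ a0)) => //.
  by move=> x ax; rewrite dF// (lt_le_trans a0).
Unshelve. all: by end_near. Qed.

End regularity.

Section integrability.
Context {R : realType} (m J : nat) (nu : probability (measurableTypeR R) R).
Notation mu := (@lebesgue_measure R).
Notation p := (schoenberg_density m J.+1 nu).
Hypothesis m0 : (0 < m)%N.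
Let c : R := 2 / Beta (m%:R / 2) J.+1%:R.
Let C k : R := \sum_(r < k.+1) `|euler_coef m J c k r|.

Let C0 k : 0 <= C k. Proof. by apply: sumr_ge0. Qed.

Let mitv (i : interval R) : measurable ([set` i] : set (measurableTypeR R)).
Proof. exact: measurable_itv. Qed.

Let nonatom k (x : R) : 0 < x -> nu [set x] = 0%E ->
  k = J -> {for x, continuous (tail_moment nu (m + J.*2) 0)}.
Proof. by move=> x0 nux _; exact: continuous_tail_moment0. Qed.

Let scaled_derive1nE k (x : R) : (k <= J)%N -> 0 < x -> nu [set x] = 0%E ->
  x ^+ k * derive1n k p x = euler_sum nu m J c k x.
Proof.
move=> kJ x0 nux.
rewrite (derive1n_euler_sum (@schoenberg_densityE_pos R m J nu) kJ x0); last first.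
  exact: nonatom.
by rewrite mulrA mulfV ?mul1r// expf_neq0// gt_eqF.
Qed.

Lemma derivable_nonatom k (x : R) : (k < J)%N -> 0 < x -> nu [set x] = 0%E ->
  derivable (derive1n k p) x 1.
Proof.
move=> kJ x0 nux.
apply: (derivable_derive1n (@schoenberg_densityE_pos R m J nu) kJ x0).
exact: nonatom.
Qed.

(** The bound on x^k p^(k)(x) is a multiple of H(x), and x H(x) is at most the
    mass of ]x, +oo[. *)
Lemma derive1n_littleo k : (k <= J)%N -> (forall x : R, 0 < x -> nu [set x] = 0%E) ->
  derive1n k p =o_+oo (fun x : R => x ^- k.+1).
Proof.
move=> kJ nu1; apply/eqoP => e e0.
have eC : 0 < e / (C k + 1) by rewrite divr_gt0// ltr_wpDl.
have := @tail_measure_cvg0 R nu => /cvgrPdist_le/(_ _ eC) H.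
near=> x.
have x0 : 0 < x by near: x; apply: nbhs_pinfty_gt; rewrite num_real.
have Hx : `|0 - fine (nu `]x, +oo[%classic)| <= e / (C k + 1) by near: x.
have -> : derive1n k p x = x ^- k * euler_sum nu m J c k x.
  by rewrite -scaled_derive1nE ?nu1// mulrA mulVf ?mul1r// expf_neq0// gt_eqF.
rewrite normrM (ger0_norm (_ : 0 <= x ^- k)); last first.
  by rewrite invr_ge0 exprn_ge0// ltW.
rewrite (ger0_norm (_ : 0 <= x ^- k.+1)); last first.
  by rewrite invr_ge0 exprn_ge0// ltW.
rewrite exprSr invfM mulrA (mulrC e) -mulrA ler_wpM2l//.
  by rewrite invr_ge0 exprn_ge0// ltW.
apply: (le_trans (euler_sum_le nu m0 c x0 kJ)).
rewrite ler_pdivlMr// -mulrA (mulrC _ x).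
apply: (@le_trans _ _ ((C k + 1) * (e / (C k + 1)))); last first.
  by rewrite mulrC divfK// gt_eqF// ltr_wpDl.
apply: ler_pM => //.
- exact: C0.
- by rewrite mulr_ge0 ?tail_moment_ge0// ltW.
- by rewrite lerDl.
apply: (le_trans (tail_moment10_le_tail_measure nu x0)).
by apply: le_trans Hx; rewrite sub0r normrN ler_norm.
Unshelve. all: by end_near. Qed.

(** The tail integral H is dominated by the Hardy transform of |g|. *)
Lemma Lp_pos_scaled_derive1n (g : R -> R) (q : R) k :
  nu `]-oo, 0[%classic = 0%E -> density_on `[0%R, +oo[ nu g ->
  1 <= q -> Lp_pos q%:E g -> (k <= J)%N ->
  Lp_pos q%:E (fun x => x ^+ k * derive1n k p x).
Proof.
move=> nu0 nug q1 Lg kJ; have q0 : 0 < q := lt_le_trans ltr01 q1.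
have nu1 (x : R) : 0 < x -> nu [set x] = 0%E.
  move=> x0; apply: (density_null (mitv _) nug) => //; last exact: lebesgue_measure_set1.
  by move=> y /= ->; rewrite in_itv/= andbT ltW.
(* The density is cut off and made nonnegative, to be defined on the whole line. *)
pose gg (x : R) : R := `|(g \_ `]0%R, +oo[) x|.
move: Lg => /andP[]; rewrite !inE/= => mg0 fg.
have mgg : measurable_fun [set: measurableTypeR R] gg by exact: measurableT_comp.
have gg0 x : 0 <= gg x by exact: normr_ge0.
have ggE (x : R) : 0 < x -> gg x = `|g x|.
  by move=> x0; rewrite /gg patchE ifT// inE/= in_itv/= x0.
pose H x := (\int[mu]_(u in `]x, +oo[) (gg u / u)%:E)%E.
have Hpos x : 0 < x -> (0 <= H x)%E.
  move=> x0; apply: integral_ge0 => u/=; rewrite in_itv/= andbT => xu.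
  by rewrite lee_fin divr_ge0// ltW// (lt_trans x0).
have tail_H x : 0 < x -> ((tail_moment nu 1 0 x)%:E <= H x)%E.
  move=> x0; have intx : nu.-integrable `]x, +oo[ (EFin \o fun u => u^-1).
    apply/integrable_mkcond => //.
    rewrite (_ : _ \_ _ = EFin \o tail_kernel 1 0 x); first exact: integrable_tail_kernel.
    apply/funext => u; rewrite patchE /= tail_kernel10_eq.
    by case: ifPn; rewrite ?inE ?notin_setE/= in_itv/= andbT;
      [move=> ->|move=> /negP/negbTE ->].
  have -> : (tail_moment nu 1 0 x)%:E = (\int[nu]_(u in `]x, +oo[) (u^-1)%:E)%E.
    rewrite -[RHS]fineK; last exact: integrable_fin_num intx.
    congr (_%:E); rewrite /tail_moment -[RHS]/(Rintegral _ _ _) [RHS]Rintegral_mkcond.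
    apply: eq_Rintegral => u _; rewrite patchE.
    by case: ifPn; rewrite ?inE ?notin_setE/= in_itv/= andbT tail_kernel10_eq;
      [move=> ->|move=> /negP/negbTE ->].
  rewrite (integral_density nu0 nug (ltW x0) intx) /H.
  have [mg _] := nug.
  have sub : `]x, +oo[ `<=` `[0, +oo[.
    by move=> u /=; rewrite !in_itv/= !andbT => /(lt_trans x0)/ltW.
  apply: (le_trans (lee_abs _)); apply: (le_trans (le_abse_integral _ _ _)) => //.
    apply/measurable_EFinP; apply: measurable_funM.
      by move/measurable_int : intx => /measurable_EFinP.
    exact: measurable_funS mg.
  rewrite le_eqVlt; apply/orP; left; apply/eqP; apply: eq_integral => u.
  rewrite inE/= in_itv/= andbT => xu; have u0 := lt_trans x0 xu.
  have ui0 : 0 < u^-1 by rewrite invr_gt0.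
  by rewrite normrM ggE// (gtr0_norm ui0) mulrC.
have mH : measurable_fun (`]0%R, +oo[%classic : set (measurableTypeR R)) H.
  have mw : measurable_fun [set: measurableTypeR R] (fun u => gg u * u `^ (- 1)).
    exact: measurable_funM.
  have w0 u : 0 <= gg u * u `^ (- 1) by rewrite mulr_ge0 ?powR_ge0.
  apply: eq_measurable_fun (measurable_tail_integral
    (@measurable_cst _ _ (measurableTypeR R) _ setT (1 : R)) mw (fun=> ler01) w0).
  move=> x; rewrite inE/= in_itv/= andbT => x0.
  apply: eq_integral => u; rewrite inE/= in_itv/= andbT => xu.
  by rewrite mul1r powR_inv1// ltW// (lt_trans x0).
have mh : measurable_fun (`]0%R, +oo[%classic : set (measurableTypeR R))
    (fun x => x ^+ k * derive1n k p x).
  apply: eq_measurable_fun (measurable_euler_sum nu m c kJ) => x.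
  by rewrite inE/= in_itv/= andbT => x0; rewrite scaled_derive1nE// nu1.
apply: (Lp_pos_dominated q1 (C0 k) mh mH) => // [x x0|].
  rewrite scaled_derive1nE ?nu1//.
  apply: (@le_trans _ _ ((C k)%:E * (tail_moment nu 1 0 x)%:E)%E).
    by rewrite -EFinM lee_fin; exact: euler_sum_le.
  by apply: lee_wpmul2l; rewrite ?lee_fin ?C0//; exact: tail_H.
apply: (le_lt_trans (hardy mgg gg0 q1)).
rewrite lte_mul_pinfty//; first by rewrite lee_fin mulr_ge0// powR_ge0.
move: fg; rewrite /finite_norm unlock /Lnorm => fg.
have := lty_poweRy (_ : q^-1 != 0) fg; rewrite invr_eq0 gt_eqF// => /(_ isT).
apply: le_lt_trans.
rewrite [leLHS]integral_mkcond; apply: ge0_le_integral => //.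
- by move=> u _; rewrite patchE; case: ifPn; rewrite // lee_fin powR_ge0.
- apply/(measurable_restrictT _ _).1 => //; apply/measurable_EFinP/measurable_funTS.
  exact: (measurableT_comp (measurable_powR q)).
- apply/measurable_EFinP; exact: (measurableT_comp (measurable_powR q)).
- move=> u _; rewrite patchE; case: ifPn => [_|_]; last by rewrite lee_fin powR_ge0.
  by rewrite /gg.
Qed.

Section finite_inverse_moment.
Hypothesis int10 : (\int[nu]_(u in `]0%R, +oo[) (u^-1)%:E < +oo)%E.
Let I : R := \int[nu]_(u in `]0%R, +oo[) u^-1.

Lemma schoenberg_density_cvg0 :
  p x @[x --> 0^'+] --> c * (0 ^+ m.-1 * I).
Proof.
apply: (@cvg_trans _ (c * scaled_moment nu m J 0 x @[x --> 0^'+])).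
  apply: near_eq_cvg; near=> x.
  have x0 : 0 < x by near: x; exact: nbhs_right_gt.
  by rewrite schoenberg_densityE_pos.
rewrite /I -tail_moment10_0; apply: cvgMr; exact: scaled_moment0_cvg0.
Unshelve. all: by end_near. Qed.

Lemma schoenberg_density0 : p 0 = c * (0 ^+ m.-1 * I).
Proof.
rewrite /schoenberg_density /c (mulrAC 2) -!mulrA; congr (_ * (_ * _)).
have [->|m1] := eqVneq m 1%N; last first.
  have e0 : (0 < m.-1)%N by rewrite -ltnS prednK// ltn_neqAle eq_sym m1.
  by rewrite [0 ^+ m.-1]expr0n eqn0Ngt e0 !mul0r.
congr (_ * _); apply: eq_Rintegral => u; rewrite inE/= in_itv/= andbT => u0.
by rewrite (expr0n _ 2) mul0r subr0 expr1n mul1r expr1.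
Qed.

(** At an atom of nu the derivative of order J may fail to exist, hence the
    exceptional set of atoms. *)
Lemma scaled_derive1n_bounded k : (k <= J)%N ->
  {ae mu, forall x : R, 0 < x ->
     forall i : nat, (i < k)%N -> derivable (derive1n i p) x 1} /\
  Lp_pos +oo%E (fun x => x ^+ k * derive1n k p x).
Proof.
move=> kJ; pose N := [set x : R | nu [set x] <> 0%E].
have cN : countable N by exact: atoms_countable.
split.
  exists N; split.
  - exact: countable_measurable.
  - exact: countable_lebesgue_measure0.
  move=> x /= hx; apply: contrapT => /contrapT nux; apply: hx => x0 i ik.
  by apply: derivable_nonatom => //; exact: leq_trans kJ.
have E (x : R) : 0 < x -> ~ N x -> x ^+ k * derive1n k p x = euler_sum nu m J c k x.
  by move=> x0 /contrapT nux; exact: scaled_derive1nE.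
apply: (@Linfty_pos_bounded _ _ (C k * I) N) => //.
- by rewrite mulr_ge0// /I -tail_moment10_0 tail_moment_ge0.
- apply: (measurable_fun_countable_modification cN _ (measurable_euler_sum nu m c kJ)).
  by move=> x; rewrite /= in_itv/= andbT; exact: E.
move=> x x0 Nx; rewrite E//; apply: (le_trans (euler_sum_le nu m0 c x0 kJ)).
apply: ler_wpM2l; first exact: C0.
by rewrite /I -tail_moment10_0; exact: tail_moment10_le0.
Qed.

End finite_inverse_moment.

End integrability.

Theorem theorem3p9 (R : realType) (m j : nat) (f : R -> R)
    (nu_m nu : probability (measurableTypeR R) R) :
  (0 < m)%N -> (0 < j)%N ->
  radial_positive_definite m f ->
  ~ (exists c : R, forall r : R, 0 <= r -> f r = c) ->
  schoenberg_measure m f nu_m ->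
  radial_positive_definite (m + 2 * j) f ->
  schoenberg_measure (m + 2 * j) f nu ->
  let p_m : R -> R := schoenberg_density m j nu in
  density_on `]0%R, +oo[ nu_m p_m ->
  [/\ ACk_loc j (distribution_function nu_m),
      (forall (g : R -> R) (p : R),
         density_on `[0%R, +oo[ nu g -> 1 <= p -> Lp_pos p%:E g ->
         forall k : nat, (k < j)%N ->
           [/\ diff_on_pos k p_m,
               Lp_pos p%:E (fun x => x ^+ k * derive1n k p_m x)
             & derive1n k p_m =o_+oo (fun x : R => x ^- k.+1)])
    & ((\int[nu]_(u in `]0%R, +oo[) (u^-1)%:E < +oo)%E ->
       let I : R := \int[nu]_(u in `]0%R, +oo[) u^-1 in
       [/\ (1 < m)%N -> p_m 0 = 0 /\ p_m x @[x --> 0^'+] --> (0 : R),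
           m = 1%N ->
             [/\ p_m 0 = 2 / Beta (1 / 2) j%:R * I,
                 p_m x @[x --> 0^'+] --> p_m 0
               & j = 1%N -> p_m 0 = I]
         & forall k : nat, (k < j)%N ->
             {ae lebesgue_measure, forall x : R, 0 < x ->
                forall i : nat, (i < k)%N -> derivable (derive1n i p_m) x 1} /\
             Lp_pos +oo%E (fun x => x ^+ k * derive1n k p_m x)])].
Proof.
case: m => // m' m0; case: j => // J _; set m1 := m'.+1 in m0 *.
move=> _ _ _ _ [nu0 _] p_m dens; split.
- exact: ACk_loc_distribution_function dens.
- move=> g p nug p1 Lg k; rewrite ltnS => kJ.
  have nu1 (x : R) : 0 < x -> nu [set x] = 0%E.
    move=> x0; apply: (density_null _ nug); first exact: measurable_itv.
    - exact: measurable_set1.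
    - by move=> y /= ->; rewrite in_itv/= andbT ltW.
    - exact: lebesgue_measure_set1.
  split.
  + move=> i x ik x0; apply: derivable_nonatom => //; last exact: nu1.
    exact: leq_trans kJ.
  + exact: (Lp_pos_scaled_derive1n m0 nu0 nug p1 Lg kJ).
  + exact: derive1n_littleo.
- move=> int10 I.
  have cvg0 := @schoenberg_density_cvg0 R m1 J nu m0 int10.
  have val0 := @schoenberg_density0 R m1 J nu m0.
  split=> [m_gt1|m_eq1|k].
  + have m1_gt0 : (0 < m1.-1)%N by rewrite -ltnS prednK.
    have e0 : 0 ^+ m1.-1 = 0 :> R by rewrite expr0n eqn0Ngt m1_gt0.
    rewrite e0 mul0r mulr0 in cvg0 val0.
    by split; [exact: val0|exact: cvg0].
  + have p0 : p_m 0 = 2 / Beta (1 / 2) J.+1%:R * I.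
      by rewrite /p_m val0 m_eq1 expr0 mul1r.
    split => [//||].
      by rewrite /p_m val0; exact: cvg0.
    by move=> [J0]; rewrite p0 J0 Beta_half_1 divff// mul1r.
  + rewrite ltnS => kJ; exact: scaled_derive1n_bounded.
Qed.
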